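(* Let $P\in\mathbb{E}(\mu)$ and let $R$ be a probability measure on $(\mathbb{X}^{\mathbb{Z}},\mathcal{X}^{\mathbb{Z}})$ with $R_n\ll\mu^n$ for all $n$. Then for every $n\ge1$, $$\frac{\mathbb{E}[-\log R_\mu(X_{1:n})]}{n}-h_\mu\ \ge\ \mathbb{E}\,D\big(P^{(\infty)}\,\|\,\bar R^{(n)}\big).$$
   Context: $(\mathbb{X},\mathcal{X})$ is a countably generated measurable space with a $\sigma$-finite measure $\mu$; on $(\mathbb{X}^{\mathbb{Z}},\mathcal{X}^{\mathbb{Z}})$, $X_k$ are coordinate maps, $x_{j:k}=(x_j,\dots,x_k)$, $R_n(A)=R(X_{1:n}\in A)$, $R_\mu(x_{1:n})=dR_n/d\mu^n$, and $R_\mu$ of the empty tuple is $1$. Conditional densities: $R_\mu(x_{n+1:n+m}|x_{1:n})=R_\mu(x_{1:n+m})/R_\mu(x_{1:n})$, where $R_\mu$ applied to a tuple of length $k$ means the density of $R_k$; thus $R_\mu(x|X_{-i:-1})=R_\mu(X_{-i},\dots,X_{-1},x)/R_\mu(X_{-i},\dots,X_{-1})$. $\mathbb{E}$: shift-stationary ergodic probability measures; for $P\in\mathbb{E}$ with $P_n\ll\mu^n$, $h_\mu=\lim_n\mathbb{E}[-\log P_\mu(X_{1:n})]/n$; $\mathbb{E}(\mu)=\{P\in\mathbb{E}: P_n\ll\mu^n\ \forall n,\ |h_\mu|<\infty\}$; expectations refer to $P$. For $P\in\mathbb{E}(\mu)$, the limit $P^{(\infty)}_\mu(x)=\lim_{n}P_\mu(x|X_{-n:-1})$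 exists a.s. and $h_\mu=\mathbb{E}[-\log P^{(\infty)}_\mu(X_0)]$; $P^{(\infty)}(A)=\int_AP^{(\infty)}_\mu d\mu$. Cesàro mean estimator: $\bar R^{(n)}_\mu(x)=\frac1n\sum_{i=0}^{n-1}R_\mu(x|X_{-i:-1})$ and $\bar R^{(n)}(A)=\int_A\bar R^{(n)}_\mu d\mu$. $D(P^{(\infty)}\|\bar R^{(n)})=\int P^{(\infty)}_\mu\log\frac{P^{(\infty)}_\mu}{\bar R^{(n)}_\mu}d\mu$ (a random variable). *)

(* Defs.v *)
From HB Require Import structures.
From mathcomp Require Import all_boot all_order all_algebra.
From mathcomp Require Import all_classical all_reals all_analysis.
Set Implicit Arguments. Unset Strict Implicit. Unset Printing Implicit Defensive.
Import Order.TTheory GRing.Theory Num.Theory.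
Local Open Scope classical_set_scope.
Local Open Scope ring_scope.

Section Defs.
Context {d : measure_display} {X : measurableType d} {R : realType}.

Definition countably_generated : Prop :=
  exists G : nat -> set X, (@measurable d X) = <<s range G >>.

Definition coord_gen : set (set (int -> X)) :=
  [set B | exists (k : int) (A : set X), measurable A /\ B = (fun w => w k) @^-1` A].

Definition seqspace := g_sigma_algebraType coord_gen.

Definition shift (w : seqspace) : seqspace := fun k => w (k + 1)%R.

Definition stationary (P : probability seqspace R) : Prop :=
  forall A : set seqspace, measurable A -> P (shift @^-1` A) = P A.

Definition ergodic (P : probability seqspace R) : Prop :=
  forall A : set seqspace, measurable A -> shift @^-1` A = A ->
    P A = 0%E \/ P A = 1%E.

Definition Xblock (n : nat) (w : seqspace) : n.-tuple X :=
  [tuple w (i.+1)%:Z | i < n].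

Definition past_with (i : nat) (w : seqspace) (x : X) : i.+1.-tuple X :=
  [tuple if (j < i)%N then w (j%:Z - i%:Z)%R else x | j < i.+1].

Definition past (i : nat) (w : seqspace) : i.-tuple X :=
  [tuple w (j%:Z - i%:Z)%R | j < i].

Variable mu : {measure set X -> \bar R}.

(* integral w.r.t. the n-fold product measure mu^n of a [0,+oo]-valued
   function, computed as the iterated integral (Tonelli) *)
Fixpoint int_mu_pow (n : nat) : (n.-tuple X -> \bar R) -> \bar R :=
  match n with
  | 0%N => fun f => f [tuple]
  | m.+1 => fun f => (\int[mu]_x int_mu_pow (fun t : m.-tuple X => f (cons_tuple x t)))%E
  end.

Definition is_density (Q : probability seqspace R) (n : nat) (r : n.-tuple X -> R) : Prop :=
  [/\ (forall t, 0 <= r t), measurable_fun setT r &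
      forall A : set (n.-tuple X), measurable A ->
        Q (Xblock n @^-1` A) = int_mu_pow (fun t => (\1_A t * r t)%:E)].

Definition cond_dens (r : forall n, n.-tuple X -> R) (i : nat) (w : seqspace) (x : X) : R :=
  r i.+1 (past_with i w x) / r i (past i w).

Definition cesaro (r : forall n, n.-tuple X -> R) (n : nat) (w : seqspace) (x : X) : R :=
  n%:R^-1 * \sum_(i < n) cond_dens r i w x.

Definition cond_inf (p : forall n, n.-tuple X -> R) (w : seqspace) (x : X) : \bar R :=
  lim ((fun n => (cond_dens p n w x)%:E) @ \oo).

(* D(P^{(∞)} || \bar R^{(n)}) = ∫ P^∞_mu log (P^∞_mu / \bar R^{(n)}_mu) dmu,
   with the conventions 0 log(0/q) = 0 and p log(p/0) = +oo *)
Definition KLterm (a : \bar R) (b : R) : \bar R :=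
  if (a == 0)%E then 0%E else (a * (lne a - lne b%:E))%E.

Definition Dinf (p r : forall n, n.-tuple X -> R) (n : nat) (w : seqspace) : \bar R :=
  (\int[mu]_x KLterm (cond_inf p w x) (cesaro r n w x))%E.

End Defs.

(* Main.v *)
Require Import Defs.
From HB Require Import structures.
From mathcomp Require Import all_boot all_order all_algebra.
From mathcomp Require Import all_classical all_reals all_analysis.
From mathcomp Require Import measurable_realfun ring lra zify.
Import Order.TTheory GRing.Theory Num.Theory.
Import numFieldNormedType.Exports.
Local Open Scope classical_set_scope.
Local Open Scope ring_scope.
Set Implicit Arguments. Unset Strict Implicit. Unset Printing Implicit Defensive.

(** Let M_m(w, x) = p(x | X_{-m:-1}(w)), a function on the product of P and mu.
    By stationarity, M_m is the density with respect to P x mu of the law of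
    (past, X_0) on the sigma-algebra of (X_{-m:-1}, x). Hence integrals of M_m g
    over P x mu are expectations of g(past, X_0), and M_m converges almost
    everywhere by the crossing argument for likelihood ratios. Gibbs' inequality
    makes E log M_m(X_0) nondecreasing for large m, with Cesaro limit -h, so
    E log M_m(X_0) <= -h for large m. If b denotes the Cesaro mean estimator,
    concavity of the logarithm gives -E log b(X_0) <= E[-log R_mu(X_{1:n})]/n.
    For large m the integral of M_m log(M_m/b) - M_m + b >= 0 over P x mu is
    E log M_m(X_0) - E log b(X_0) - 1 plus the integral of b. Fatou's lemma
    bounds by this the same integral for the limit of M_m, and since that limit
    has integral at most 1, the claim follows without uniform integrability and
    without knowing that the limit is a probability density. *)

(** * Crossings and almost everywhere convergence of likelihood ratios *)

(** Convergence of M_m is needed almost everywhere for P x mu, because D integrates over x with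
    respect to mu and not along the symbol X_0. This measure may be infinite, and the law N of (w,
    X_0) may be singular to it. But N has mass 1 and has density M_m on the sets that depend on m
    past symbols and x, and counting crossings uses no more than this. A logarithmic ratio has no
    sign, so Fatou's lemma does not apply to it directly; adding b - M_m makes it nonnegative, and
    the correction is paid back by the integrals of b and of the limit. Since R need not dominate P,
    quotients with denominator 0 do occur; they are read as 0, so conditional densities of R have
    integral at most 1 over P x mu, not always 1. Expectations of logarithms may fail to be finite
    for short pasts; there only positive parts are controlled, by ln t <= t - 1. *)

Section oscillation.
Context {R : realType}.
Implicit Types (u : nat -> R).

Definition oscillates (a b : R) u : Prop :=
  (forall n, exists2 m, (n <= m)%N & u m < a) /\
  (forall n, exists2 m, (n <= m)%N & b < u m).

Lemma cvgn_limn_einf_eq_esup (v : (\bar R)^nat) :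
  limn_einf v = limn_esup v -> v @ \oo --> limn_esup v.
Proof.
rewrite limn_einf_lim limn_esup_lim => e.
apply: (@squeeze_cvge _ _ _ _ (einfs v) v (esups v)).
- by apply: nearW => n; rewrite ereal_inf_lbound ?ereal_sup_ubound//=; exists n => //=.
- by rewrite -e; exact: is_cvg_einfs.
- exact: is_cvg_esups.
Qed.

(** Divergence to +oo counts as convergence, so failure means that the lower limit is below the
    upper one. Rational levels make the exceptional set a countable union; nonnegativity places them
    above 0, as the crossing bound requires. *)
Lemma nonneg_cvgn_or_oscillates u : (forall n, 0 <= u n) ->
  ~ cvgn (EFin \o u) -> exists q : rat * rat,
    0 < (ratr q.1 : R) < ratr q.2 /\ oscillates (ratr q.1) (ratr q.2) u.
Proof.
move=> u0 ncv; set v := EFin \o u.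
have ilts : (limn_einf v < limn_esup v)%E.
  rewrite lt_neqAle limn_einf_sup andbT; apply/eqP => e; apply: ncv.
  by apply/cvg_ex; eexists; exact: (cvgn_limn_einf_eq_esup e).
have i0 : (0 <= limn_einf v)%E.
  rewrite limn_einf_lim; apply: lime_ge; first exact: is_cvg_einfs.
  apply: nearW => n; apply: le_ereal_inf_tmp => _ [m _ <-].
  by rewrite lee_fin.
(* The upper limit may be +oo; then any real above the lower limit serves, here the lower limit plus
   1. *)
have [y [y1 y2]] : exists y : R, (limn_einf v < y%:E /\ y%:E <= limn_esup v)%E.
  move: ilts i0; case: (limn_einf v) => [r| |]//; case: (limn_esup v) => [s| |]//.
  - by move=> rs _; exists s; split.
  - by move=> _ _; exists (r + 1); rewrite leey lte_fin ltrDl.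
have [x xE] : exists x : R, limn_einf v = x%:E.
  by move: y1 i0; case: (limn_einf v) => // r; exists r.
rewrite xE lte_fin in y1; rewrite xE lee_fin in i0.
have [p /itvP pi] := rat_in_itvoo y1.
have py : ratr p < y by rewrite pi.
have [q /itvP qi] := rat_in_itvoo py.
exists (p, q) => /=; split; first by rewrite (le_lt_trans i0) ?pi// qi.
split=> n.
  have : (einfs v n < (ratr p)%:E)%E.
    apply: (@le_lt_trans _ _ (limn_einf v)); last by rewrite xE lte_fin pi.
    rewrite limn_einf_lim; apply: lime_ge; first exact: is_cvg_einfs.
    by exists n => // m /= nm; exact: nondecreasing_einfs.
  by move=> /ereal_inf_lt[_ [m nm <-]]; rewrite lte_fin; exists m.
have : ((ratr q)%:E < esups v n)%E.
  apply: (@lt_le_trans _ _ (limn_esup v)).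
    by apply: lt_le_trans y2; rewrite lte_fin qi.
  rewrite limn_esup_lim; apply: lime_le; first exact: is_cvg_esups.
  by exists n => // m /= nm; exact: nonincreasing_esups.
by move=> /ereal_sup_gt[_ [m nm <-]]; rewrite lte_fin; exists m.
Qed.

End oscillation.

Section likelihood_ratio.
Context d (T : measurableType d) (R : realType).
Variables (nu N : {measure set T -> \bar R}) (M : nat -> T -> R).
(** A filtration made of algebras of sets: whether a phase ends at time j is decided by finitely
    many Boolean operations on level sets of M_0, ..., M_j. *)
Variable F : nat -> set (set T).
Hypothesis F_measurable : forall j A, F j A -> measurable A.
Hypothesis F_setT : forall j, F j setT.
Hypothesis F_setC : forall j A, F j A -> F j (~` A).
Hypothesis F_setI : forall j A B, F j A -> F j B -> F j (A `&` B).
Hypothesis F_mono : forall j A, F j A -> F j.+1 A.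
Hypothesis M_lt : forall j a, F j [set x | M j x < a].
Hypothesis M_gt : forall j b, F j [set x | b < M j x].
Hypothesis N_density : forall j A, F j A -> N A = (\int[nu]_(x in A) (M j x)%:E)%E.
Hypothesis M_ge0 : forall j x, 0 <= M j x.
Hypothesis N_le1 : (N setT <= 1)%E.

Let F_setU j A B : F j A -> F j B -> F j (A `|` B).
Proof.
by move=> FA FB; rewrite -[_ `|` _]setCK setCU; apply/F_setC/F_setI; exact: F_setC.
Qed.

Let M_measurable j A : measurable A -> measurable_fun A (fun x => (M j x)%:E).
Proof.
move=> mA; apply: measurable_funTS; apply/measurable_EFinP.
apply: (measurability _ (RGenOInfty.measurableE R)).
move=> _ [_ [a ->] <-]; rewrite setTI.
rewrite (_ : _ @^-1` _ = [set x | a < M j x]).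
  exact: (F_measurable (M_gt j a)).
by apply/seteqP; split=> x /=; rewrite in_itv/= andbT.
Qed.


Lemma likelihood_ratio_ge j A b : 0 <= b -> F j A -> A `<=` [set x | b < M j x] ->
  (b%:E * nu A <= N A)%E.
Proof.
move=> b0 FA Ab; have mA := F_measurable FA.
rewrite (N_density FA) -integral_cst//; apply: ge0_le_integral => //.
- exact: M_measurable.
- by move=> x /Ab /= /ltW; rewrite lee_fin.
Qed.

Lemma likelihood_ratio_le j A a : F j A -> A `<=` [set x | M j x < a] ->
  (N A <= a%:E * nu A)%E.
Proof.
move=> FA Aa; have mA := F_measurable FA.
rewrite (N_density FA) -integral_cst//; apply: ge0_le_integral => //.
- by move=> x _; rewrite lee_fin.
- exact: M_measurable.
- by move=> x /Aa /= /ltW; rewrite lee_fin.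
Qed.

Section crossings.
Variables a b : R.
Hypothesis a_gt0 : 0 < a.
Hypothesis ab : a < b.

Let b_gt0 : 0 < b. Proof. exact: (lt_trans a_gt0 ab). Qed.

(* In an even phase one waits for M to exceed b, in an odd one for it to drop below a. *)
Let exits (k i : nat) (x : T) : bool := if odd k then M i x < a else b < M i x.

(** The number of phases completed before time i. It depends on M_0, ..., M_{i-1} only, so the end
    of a phase is a stopping time. *)
Let phase (x : T) := fix phase (i : nat) : nat :=
  if i is i'.+1 then (phase i' + exits (phase i') i' x)%N else 0%N.

Let phase_end (k i : nat) : set T := [set x | phase x i = k /\ exits k i x].

Let F_exits k i : F i [set x | exits k i x].
Proof. by rewrite /exits; case: (odd k); [exact: M_lt|exact: M_gt]. Qed.

Let F_set0 i : F i set0.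
Proof. by rewrite -setCT; exact/F_setC/F_setT. Qed.

Let F_phase i k : F i [set x | phase x i = k].
Proof.
elim: i k => [|i IH] [|k] /=.
- by rewrite (_ : mkset _ = setT)//; apply/seteqP; split.
- by rewrite (_ : mkset _ = set0)//; apply/seteqP; split.
- rewrite (_ : mkset _ = [set x | phase x i = 0%N] `&` ~` [set x | exits 0 i x]).
    exact: F_mono (F_setI (IH 0%N) (F_setC (F_exits 0 i))).
  apply/seteqP; split=> x /=.
    by move=> /eqP; rewrite addn_eq0 => /andP[/eqP -> /eqP]; case: exits.
  by move=> [-> /negP]; case: exits.
- rewrite (_ : mkset _ = ([set x | phase x i = k.+1] `&` ~` [set x | exits k.+1 i x])
     `|` ([set x | phase x i = k] `&` [set x | exits k i x])).
    apply: F_mono; apply: F_setU; apply: F_setI => //.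
    exact: F_setC (F_exits k.+1 i).
  apply/seteqP; split=> x /=.
    case e : exits; rewrite ?addn1 ?addn0 => h.
      by right; case: h e => ->.
    by left; rewrite -h; split => //; rewrite e.
  by move=> [[-> /negP]|[-> ->]]; [case: exits; rewrite ?addn0|rewrite addn1].
Qed.

Let F_phase_end k i : F i (phase_end k i).
Proof. exact: (F_setI (F_phase i k) (F_exits k i)). Qed.

Let measurable_phase_end k i : measurable (phase_end k i).
Proof. exact: F_measurable (F_phase_end k i). Qed.

Let le_phase x i j : (i <= j)%N -> (phase x i <= phase x j)%N.
Proof.
elim: j => [|j IH]; first by rewrite leqn0 => /eqP ->.
rewrite leq_eqVlt => /predU1P[->//|]; rewrite ltnS => /IH h /=.
by rewrite (leq_trans h)// leq_addr.
Qed.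

Let trivIset_phase_end k : trivIset setT (phase_end k).
Proof.
have key x i j : (i < j)%N -> phase_end k i x -> ~ phase_end k j x.
  move=> ij [pi ei] [pj _]; have := le_phase x ij.
  by rewrite /= pi ei pj addn1 ltnn.
apply/trivIsetP => i j _ _ /eqP ij; apply/seteqP; split => // x [xi xj].
by have [h|h|//] := ltngtP i j; [exact: (key _ _ _ h xi)|exact: (key _ _ _ h xj)].
Qed.

Let phase_ended k := \bigcup_i phase_end k i.

Let measurable_phase_ended k : measurable (phase_ended k).
Proof. exact: bigcupT_measurable. Qed.

Let phase_endedS k : phase_ended k.+1 `<=` phase_ended k.
Proof.
move=> x [i _ [pi _]]; elim: i pi => [//|i IH] /=.
case e : exits; rewrite ?addn1 ?addn0 => h; last exact: IH.
by exists i => //; case: h e => <-.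
Qed.

(** The event splits according to the time i at which the phase ends; each piece lies in [F i],
    where M_i is the density of N and exceeds b. *)
Let phase_ended_up k : ~~ odd k -> (b%:E * nu (phase_ended k) <= N (phase_ended k))%E.
Proof.
move=> /negbTE ok; rewrite /phase_ended !measure_bigcup//= -nneseriesZl//.
apply: lee_nneseries => i _; first by rewrite mule_ge0// lee_fin ltW.
apply: (@likelihood_ratio_ge i) => //; first exact: ltW.
by move=> x [_]; rewrite /exits ok.
Qed.

Let phase_ended_down k : odd k -> (N (phase_ended k) <= a%:E * nu (phase_ended k))%E.
Proof.
move=> ok; rewrite /phase_ended !measure_bigcup//= -nneseriesZl//.
apply: lee_nneseries => i _; first by [].
by apply: (@likelihood_ratio_le i) => // x [_]; rewrite /exits ok.
Qed.

(** A descent gives N <= a nu and the next ascent gives b nu <= N, so each round trip costs a factor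
    a / b. The first ascent yields 1 / b from the total mass of N, which makes the bound finite even
    when nu is infinite. *)
Let phase_ended_bound k : (nu (phase_ended k.*2) <= ((a / b) ^+ k / b)%:E)%E.
Proof.
elim: k => [|k IH].
  rewrite expr0 div1r -[leRHS]mule1 -lee_pdivrMl ?invr_gt0// invrK.
  rewrite (le_trans (phase_ended_up _))//= (le_trans _ N_le1)// le_measure ?inE//.
have -> : (a / b) ^+ k.+1 / b = b^-1 * (a * ((a / b) ^+ k / b)).
  by rewrite exprS; ring.
rewrite EFinM -lee_pdivrMl ?invr_gt0// invrK doubleS.
apply: (le_trans (phase_ended_up _)); first by rewrite /= odd_double.
apply: (@le_trans _ _ (N (phase_ended k.*2.+1))).
  by apply: le_measure; rewrite ?inE//; exact: phase_endedS.
apply: (le_trans (phase_ended_down _)); first by rewrite /= odd_double.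
rewrite EFinM lee_pmul2l ?lte_fin// (le_trans _ IH)//.
by apply: le_measure; rewrite ?inE//; exact: phase_endedS.
Qed.

Let oscillates_phase_ended x k : oscillates a b (M ^~ x) -> phase_ended k x.
Proof.
move=> [lo hi].
have freq l n : exists2 m, (n <= m)%N & exits l m x.
  by rewrite /exits; case: (odd l); [exact: lo|exact: hi].
have main l : exists i, phase x i = l.
  elim: l => [|l [i pi]]; first by exists 0%N.
  (* If phase l never ended, the counter would still be l at time m, when the exit condition
     holds. *)
  have [m im em] := freq l i; apply: contrapT => nex.
  have stay j : phase x (i + j)%N = l.
    elim: j => [|j IHj]; first by rewrite addn0.
    rewrite addnS /= IHj; case e : exits; rewrite ?addn0//.
    by exfalso; apply: nex; exists (i + j).+1; rewrite /= IHj e addn1.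
  apply: nex; exists m.+1; have := stay (m - i)%N.
  by rewrite subnKC//= => ->; rewrite em addn1.
have [i pi] := main k.+1.
elim: i pi => [//|i IH] /=; case e : exits; rewrite ?addn1 ?addn0 => h; last exact: IH.
by exists i => //; case: h e => <-.
Qed.

Lemma negligible_oscillates : nu.-negligible [set x | oscillates a b (M ^~ x)].
Proof.
pose Z := \bigcap_k phase_ended k.
have mZ : measurable Z by exact: bigcapT_measurable.
exists Z; split => //; last by move=> x xo k _; exact: oscillates_phase_ended.
apply/eqP; rewrite eq_le measure_ge0 andbT.
have ab1 : `|a / b| < 1.
  by rewrite ger0_norm ?divr_ge0 ?ltW// ltr_pdivrMr ?mul1r.
have c0 : ((a / b) ^+ k / b)%:E @[k --> \oo] --> (0:R)%:E.
  apply: cvg_EFin; first exact: nearW.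
  rewrite -[X in _ --> X](mul0r b^-1); apply: cvgMl; exact: cvg_expr.
suff : (nu Z <= limn (fun k => ((a / b) ^+ k / b)%:E))%E by rewrite (cvg_lim _ c0).
apply: lime_ge; first by apply/cvg_ex; exists (0:R)%:E.
apply: nearW => k; apply: le_trans (phase_ended_bound k).
by apply: le_measure; rewrite ?inE// => x; exact.
Qed.

End crossings.

Lemma likelihood_ratio_ae_cvg : {ae nu, forall x, cvgn (fun n => (M n x)%:E)}.
Proof.
pose B (q : rat * rat) : set T :=
  if 0 < (ratr q.1 : R) < ratr q.2 then [set x | oscillates (ratr q.1 : R) (ratr q.2) (M ^~ x)]
  else set0.
have Bn q : nu.-negligible (B q).
  rewrite /B; case: ifP => [/andP[q0 q1]|_]; last exact: negligible_set0.
  exact: negligible_oscillates.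
suff : nu.-negligible (~` [set x | cvgn (fun n => (M n x)%:E)]).
  by move=> h; exact: h.
apply: (@negligibleS _ _ _ _ (\bigcup_n (if unpickle n is Some q then B q else set0))).
  move=> x /= /(nonneg_cvgn_or_oscillates (M_ge0 ^~ x)) [q [q01 osc]].
  by exists (pickle q); [|rewrite pickleK /B q01].
apply: negligible_bigcup => n; case: (unpickle n) => [q|]; first exact: Bn.
exact: negligible_set0.
Qed.

End likelihood_ratio.

(** * Integrals with respect to powers of a measure *)

Definition pushforward_measure d d' (T1 : measurableType d) (T2 : measurableType d')
    (R : realType) (m : {measure set T1 -> \bar R}) (f : T1 -> T2)
    (mf : measurable_fun setT f) : {measure set T2 -> \bar R} :=
  measure_function_pushforward__canonical__measure_function_Measure m mf.

Section density.
Local Open Scope ereal_scope.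
Context d (Y : measurableType d) (R : realType).
Variables (nu m : {measure set Y -> \bar R}) (q : Y -> R).
Hypothesis q_ge0 : forall t, (0 <= q t)%R.
Hypothesis mq : measurable_fun setT q.
Hypothesis nu_q : forall A, measurable A -> nu A = \int[m]_t (\1_A t * q t)%:E.

Import HBNNSimple.

(** The density is known on sets only; simple functions and monotone convergence extend it to
    nonnegative functions. *)
Lemma ge0_integral_density (f : Y -> \bar R) :
  measurable_fun setT f -> (forall t, 0 <= f t) ->
  \int[nu]_t f t = \int[m]_t (f t * (q t)%:E).
Proof.
move=> mf f0; pose h := nnsfun_approx measurableT mf.
have mh k : measurable_fun setT (fun t => (h k t)%:E).
  by apply/measurable_EFinP; exact: measurable_funP.
have hf t : (h k t)%:E @[k --> \oo] --> f t.
  by apply: cvg_nnsfun_approx.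
have mqE : measurable_fun setT (fun t => (q t)%:E) by exact/measurable_EFinP.
transitivity (limn (fun k => \int[nu]_t (h k t)%:E)).
  rewrite -monotone_convergence//.
  - by apply: eq_integral => t _; apply/esym/cvg_lim.
  - by move=> k t _; rewrite lee_fin.
  - by move=> t _ a b ab; rewrite lee_fin; exact/lefP/nd_nnsfun_approx.
transitivity (limn (fun k => \int[m]_t ((h k t)%:E * (q t)%:E))); last first.
  rewrite -monotone_convergence//.
  - apply: eq_integral => t _; apply: cvg_lim => //.
    by apply: cvgeZr => //; exact: hf.
  - by move=> k; apply: emeasurable_funM.
  - by move=> k t _; rewrite mule_ge0// lee_fin.
  - move=> t _ a b ab; rewrite lee_wpmul2r ?lee_fin//.
    exact/lefP/nd_nnsfun_approx.
congr (limn _); apply/funext => k.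
rewrite (integralT_nnsfun nu) sintegralE.
have hk t : (h k t)%:E * (q t)%:E =
    \sum_(y \in range (h k)) (y%:E * (\1_(h k @^-1` [set y]) t * q t)%:E).
  rewrite {1}fimfunE -fsumEFin// ge0_mule_fsuml => [|y]; last exact: nnfun_muleindic_ge0.
  by apply: eq_fsbigr => y _; rewrite !EFinM muleA.
under [RHS]eq_integral do rewrite hk.
have mi y : measurable_fun setT (fun t => (\1_(h k @^-1` [set y]) t * q t)%:E).
  by apply/measurable_EFinP/measurable_funM.
rewrite ge0_integral_fsum//; last 2 first.
- by move=> y; exact: emeasurable_funM.
- move=> y t _; rewrite EFinM muleA mule_ge0 ?lee_fin//.
  exact: nnfun_muleindic_ge0.
apply: eq_fsbigr => y /[!inE] -[t _ <-].
rewrite ge0_integralZl ?lee_fin//; last by move=> *; rewrite lee_fin mulr_ge0.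
by rewrite -nu_q.
Qed.

End density.

Lemma ge0_eq_integral_comp d d' (S : measurableType d) (Y : measurableType d')
    (R : realType) (P : {measure set S -> \bar R}) (phi psi : S -> Y) :
  measurable_fun setT phi -> measurable_fun setT psi ->
  (forall A, measurable A -> P (phi @^-1` A) = P (psi @^-1` A)) ->
  forall f : Y -> \bar R, measurable_fun setT f -> (forall y, (0 <= f y)%E) ->
  (\int[P]_w f (phi w) = \int[P]_w f (psi w))%E.
Proof.
move=> mphi mpsi e f mf f0.
have := @ge0_integral_pushforward _ _ _ _ _ _ mphi P setT f measurableT mf (fun y _ => f0 y).
have := @ge0_integral_pushforward _ _ _ _ _ _ mpsi P setT f measurableT mf (fun y _ => f0 y).
rewrite !preimage_setT /= => <- <-.
set m1 : measure _ _ := pushforward_measure P mphi.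
set m2 : measure _ _ := pushforward_measure P mpsi.
by apply: (@eq_measure_integral _ _ _ _ m2 m1) => A mA _; exact: e.
Qed.

Lemma eq_integral_comp d d' (S : measurableType d) (Y : measurableType d')
    (R : realType) (P : {measure set S -> \bar R}) (phi psi : S -> Y) :
  measurable_fun setT phi -> measurable_fun setT psi ->
  (forall A, measurable A -> P (phi @^-1` A) = P (psi @^-1` A)) ->
  forall f : Y -> \bar R, measurable_fun setT f ->
  (\int[P]_w f (phi w) = \int[P]_w f (psi w))%E.
Proof.
move=> mphi mpsi e f mf; rewrite integralE [RHS]integralE.
have hp := ge0_eq_integral_comp mphi mpsi e (measurable_funepos mf) (fun y => funepos_ge0 f y).
have hn := ge0_eq_integral_comp mphi mpsi e (measurable_funeneg mf) (fun y => funeneg_ge0 f y).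
have posE (g : S -> Y) : ((fun w => f (g w))^\+)%E = (fun w => f^\+ (g w))%E.
  exact: (funepos_comp f g).
have negE (g : S -> Y) : ((fun w => f (g w))^\-)%E = (fun w => f^\- (g w))%E.
  exact: (funeneg_comp f g).
rewrite !posE !negE; transitivity (\int[P]_w f^\+ (psi w) - \int[P]_w f^\- (phi w))%E.
  by rewrite -hp.
by rewrite -hn.
Qed.

Lemma sigma_finite_product d1 d2 (T1 : measurableType d1) (T2 : measurableType d2)
    (R : realType) (m1 : {sigma_finite_measure set T1 -> \bar R})
    (m2 : {sigma_finite_measure set T2 -> \bar R}) :
  sigma_finite setT (m1 \x m2)%E.
Proof.
have /sigma_finiteP[F [FT ndF Foo]] := sigma_finiteT m1.
have /sigma_finiteP[G [GT ndG Goo]] := sigma_finiteT m2.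
exists (fun n => F n `*` G n) => [|k].
  apply/seteqP; split=> [[x y] _|//].
  have [i _ Fi] : (\bigcup_i F i) x by rewrite -FT.
  have [j _ Gj] : (\bigcup_i G i) y by rewrite -GT.
  exists (maxn i j) => //; split=> /=.
    by move: x Fi; exact/subsetPset/ndF/leq_maxl.
  by move: y Gj; exact/subsetPset/ndG/leq_maxr.
have [mF ?] := Foo k; have [mG ?] := Goo k.
split; first exact: measurableX.
by rewrite product_measure1E// lte_mul_pinfty// ge0_fin_numE.
Qed.

Section power.
Context d (X : measurableType d) (R : realType).
Variable mu : {sigma_finite_measure set X -> \bar R}.
Local Open Scope ereal_scope.

Lemma measurable_cons_tuple n :
  measurable_fun setT (fun z : X * n.-tuple X => cons_tuple z.1 z.2).
Proof. exact: (measurable_cons measurable_fst measurable_snd). Qed.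

Lemma measurable_rcons_tuple n :
  measurable_fun setT (fun z : n.-tuple X * X => rcons_tuple z.1 z.2).
Proof.
apply/measurable_fun_tnthP => i /=.
have [ilt|ige] := ltnP i n.
  rewrite (_ : _ \o _ = fun z => tnth z.1 (Ordinal ilt)).
    apply: (measurableT_comp (measurable_tnth (Ordinal ilt))); exact: measurable_fst.
  apply/funext => z /=; rewrite (tnth_nth z.2) (tnth_nth z.2) /= nth_rcons size_tuple.
  by rewrite ilt.
rewrite (_ : _ \o _ = snd) //; apply/funext => z /=.
rewrite (tnth_nth z.2) /= nth_rcons size_tuple ltnNge ige /=.
by rewrite eqn_leq ige -ltnS ltn_ord.
Qed.

(** Turns the iterated integral of [is_density] into an integral against a genuine measure, so that
    almost everywhere statements make sense. Sigma-finiteness is carried through the induction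
    because Tonelli's theorem asks for it at the next step. *)
Lemma int_mu_pow_measure n :
  exists m : {sigma_finite_measure set (n.-tuple X) -> \bar R},
  forall f, measurable_fun setT f -> (forall t, 0 <= f t) ->
  int_mu_pow mu f = \int[m]_t f t.
Proof.
elim: n => [|n [m IH]].
  exists (dirac [tuple]) => f mf f0 /=.
  by rewrite integral_dirac// diracE in_setT mul1e.
pose c (z : X * n.-tuple X) : n.+1.-tuple X := cons_tuple z.1 z.2.
have mc : measurable_fun setT c by exact: measurable_cons_tuple.
pose u (t : n.+1.-tuple X) : X * n.-tuple X := (thead t, [tuple of behead t]).
have mu_ : measurable_fun setT u.
  apply: measurable_fun_pair; [exact: measurable_tnth|exact: measurable_behead].
have cu t : c (u t) = t by rewrite [in RHS](tuple_eta t); exact: val_inj.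
have uc z : u (c z) = z.
  by case: z => x t; congr pair; exact: val_inj.
pose pm : measure _ _ := pushforward_measure (mu \x m) mc.
(* [c] is a bijection with measurable inverse [u], so an exhaustion of the product is transported to
   tuples. *)
have sf : sigma_finite setT pm.
  have [F FT Ff] := sigma_finite_product mu m.
  exists (fun i => u @^-1` F i) => [|i].
    by rewrite -preimage_bigcup -FT preimage_setT.
  split; first by rewrite -[_ @^-1` _]setTI; apply: mu_ => //; case: (Ff i).
  rewrite /= /pushforward (_ : c @^-1` _ = F i); first by case: (Ff i).
  by apply/seteqP; split => z /=; rewrite uc.
pose Hsf := Measure_isSigmaFinite.Build _ _ _ (Measure.sort pm) sf.
pose m' := HB.pack_for (sigma_finite_measure _ _) (Measure.sort pm) Hsf.
exists m' => f mf f0.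
transitivity (\int[mu \x m]_z f (c z)).
  rewrite fubini_tonelli1//; last exact: measurableT_comp.
  apply: eq_integral => x _; rewrite /fubini_F -IH//.
  apply: measurableT_comp => //.
  exact: (measurableT_comp mc (pair1_measurable x)).
have := @ge0_integral_pushforward _ _ _ _ _ _ mc (mu \x m) setT f measurableT mf (fun y _ => f0 y).
by rewrite preimage_setT => <-.
Qed.

(** Peels off the last coordinate instead of the first. The order of integration is unchanged, as
    the last coordinate is already innermost; hence no Fubini argument and an arbitrary [f]. *)
Lemma int_mu_pow_rcons n (f : n.+1.-tuple X -> \bar R) :
  int_mu_pow mu f = int_mu_pow mu (fun t : n.-tuple X => \int[mu]_x f (rcons_tuple t x)).
Proof.
elim: n f => [|n IH] f.
  by apply: eq_integral => x _ /=; congr f; exact: val_inj.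
apply: eq_integral => x _; apply: etrans (IH (fun t => f (cons_tuple x t))) _.
congr (int_mu_pow mu _); apply/funext => t.
by apply: eq_integral => y _; congr f; exact: val_inj.
Qed.

End power.

(** * Coordinates, blocks and the shift *)

(** Inversion is discontinuous at 0; for a nonnegative denominator it is the real power with
    exponent -1, which is measurable. *)
Lemma measurable_divr_ge0 d (T : measurableType d) (R : realType) (f g : T -> R) :
  measurable_fun setT f -> measurable_fun setT g -> (forall x, 0 <= g x) ->
  measurable_fun setT (fun x => f x / g x).
Proof.
move=> mf mg g0; under eq_fun do rewrite -powR_inv1//.
apply: measurable_funM => //.
exact: (measurableT_comp (measurable_powR (-1))).
Qed.

Lemma measurable_eq0 d (T : measurableType d) (R : realType) (f : T -> R) :
  measurable_fun setT f -> measurable [set x | f x = 0].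
Proof.
move=> mf; rewrite -[X in measurable X]setTI.
exact: (mf measurableT [set 0] (measurable_set1 0)).
Qed.

Lemma measurable_gt0 d (T : measurableType d) (R : realType) (f : T -> R) :
  measurable_fun setT f -> measurable [set x | 0 < f x].
Proof.
move=> mf; rewrite (_ : mkset _ = setT `&` f @^-1` `]0, +oo[).
  by apply: mf => //; exact: measurable_itv.
by apply/seteqP; split => x; rewrite /= in_itv /= andbT// => -[].
Qed.

Section coordinates.
Context d (X : measurableType d).
Local Notation seqspace := (@seqspace d X).
Implicit Types (w : seqspace) (x : X).

Lemma measurable_coord k : measurable_fun setT (fun w : seqspace => w k).
Proof.
by move=> _ A mA; rewrite setTI; apply: sub_sigma_algebra; exists k, A.
Qed.

Lemma measurable_shift : measurable_fun setT (@Defs.shift d X).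
Proof.
move=> _; apply: (@measurability _ _ _ _ setT (@Defs.shift d X) (@coord_gen d X)) => //.
move=> _ [_ [k [A [mA ->]]] <-]; rewrite setTI.
apply: sub_sigma_algebra; exists (k + 1), A; split=> //.
Qed.

Definition front n (t : n.+1.-tuple X) : n.-tuple X :=
  [tuple tnth t (widen_ord (leqnSn n) i) | i < n].

Lemma measurable_front n : measurable_fun setT (@front n).
Proof.
apply/measurable_fun_tnthP => i; rewrite (_ : _ \o _ = fun t : n.+1.-tuple X => tnth t (widen_ord (leqnSn n) i)).
  exact: measurable_tnth.
by apply/funext => t /=; rewrite tnth_mktuple.
Qed.

Lemma front_rcons n (t : n.-tuple X) x : front (rcons_tuple t x) = t.
Proof.
apply: eq_from_tnth => i; rewrite tnth_mktuple !(tnth_nth x) /= nth_rcons.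
by rewrite size_tuple ltn_ord.
Qed.

Lemma front_Xblock n w : front (Xblock n.+1 w) = Xblock n w.
Proof. by apply: eq_from_tnth => i; rewrite !tnth_mktuple. Qed.

Lemma front_past_with n w x : front (past_with n w x) = past n w.
Proof. by apply: eq_from_tnth => i; rewrite !tnth_mktuple /= ltn_ord. Qed.

Lemma past_with_rcons n w x : past_with n w x = rcons_tuple (past n w) x.
Proof.
apply: eq_from_tnth => i; rewrite tnth_mktuple (tnth_nth x) /= nth_rcons size_map.
rewrite size_enum_ord; case: ltnP => [ilt|ige].
  by rewrite (nth_map (Ordinal ilt)) ?size_enum_ord// nth_enum_ord.
by rewrite eqn_leq ige -ltnS ltn_ord.
Qed.

(** Forgetting the oldest symbol: this is what makes the sigma-algebras of longer and longer pasts
    nested. *)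
Lemma behead_past_with n w x : [tuple of behead (past_with n.+1 w x)] = past_with n w x.
Proof.
apply: eq_from_tnth => i.
have -> : tnth [tuple of behead (past_with n.+1 w x)] i = tnth (past_with n.+1 w x) (lift ord0 i).
  by rewrite [in RHS](tuple_eta (past_with n.+1 w x)) tnthS.
rewrite !tnth_mktuple /= /bump /= add1n ltnS; case: ifP => // _; congr (w _).
by rewrite -!natz; lia.
Qed.

Lemma measurable_Xblock n : measurable_fun setT (@Xblock d X n).
Proof.
apply/measurable_fun_tnthP => i; rewrite (_ : _ \o _ = fun w : seqspace => w (i.+1)%:Z).
  exact: measurable_coord.
by apply/funext => w /=; rewrite tnth_mktuple.
Qed.

Lemma measurable_past n : measurable_fun setT (@past d X n).
Proof.
apply/measurable_fun_tnthP => i; rewrite (_ : _ \o _ = fun w : seqspace => w (i%:Z - n%:Z)).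
  exact: measurable_coord.
by apply/funext => w /=; rewrite tnth_mktuple.
Qed.

Lemma measurable_past_with n :
  measurable_fun setT (fun z : seqspace * X => past_with n z.1 z.2).
Proof.
have -> : (fun z : seqspace * X => past_with n z.1 z.2) =
    (fun z => rcons_tuple (past n z.1) z.2).
  by apply/funext => z; rewrite past_with_rcons.
have mf : measurable_fun setT (fun z : seqspace * X => z.1) by exact: measurable_fst.
have ms : measurable_fun setT (fun z : seqspace * X => z.2) by exact: measurable_snd.
have mp := measurableT_comp (@measurable_past n) mf.
exact: (measurableT_comp (@measurable_rcons_tuple _ X n) (measurable_fun_pair mp ms)).
Qed.

Lemma measurable_graph_at0 : measurable_fun setT (fun w : seqspace => (w, w 0)).
Proof. apply: measurable_fun_pair => //; exact: measurable_coord. Qed.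

Lemma measurable_past_with0 n : measurable_fun setT (fun w : seqspace => past_with n w (w 0)).
Proof. exact: (measurableT_comp (@measurable_past_with n) measurable_graph_at0). Qed.

Lemma iter_shiftE k w j : iter k (@Defs.shift d X) w j = w (j + k%:Z).
Proof.
by elim: k w j => [|k IH] w j; rewrite ?addr0// iterSr IH /Defs.shift; congr (w _); lia.
Qed.

(** The past runs over times -n to -1 and the block over 1 to n, so n + 1 shifts match them; the
    same shifts carry time 0 to n + 1. *)
Lemma past_iter_shift n w : past n (iter n.+1 (@Defs.shift d X) w) = Xblock n w.
Proof.
apply: eq_from_tnth => i; rewrite !tnth_mktuple iter_shiftE; congr (w _); lia.
Qed.

Lemma past_with_iter_shift n w :
  past_with n (iter n.+1 (@Defs.shift d X) w) (iter n.+1 (@Defs.shift d X) w 0) = Xblock n.+1 w.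
Proof.
apply: eq_from_tnth => i; rewrite !tnth_mktuple !iter_shiftE.
case: ltnP => ilt; rewrite ?iter_shiftE; congr (w _); first by lia.
by have := ltn_ord i; lia.
Qed.

Section stationary_integrals.
Context (R : realType) (P : probability seqspace R).
Hypothesis P_stat : stationary P.
Local Open Scope ereal_scope.

Lemma stationary_iter k (A : set seqspace) : measurable A ->
  P (iter k (@Defs.shift d X) @^-1` A) = P A.
Proof.
move=> mA; elim: k => [//|k IH]; rewrite -[RHS]IH -[RHS]P_stat.
  by congr (P _); apply/seteqP; split => w; rewrite /preimage /= -iterSr.
rewrite -[X in measurable X]setTI.
elim: k {IH} => [|k IH]; first by rewrite setTI.
rewrite (_ : setT `&` _ = setT `&` @Defs.shift d X @^-1` (setT `&` iter k (@Defs.shift d X) @^-1` A)).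
  exact: (measurable_shift measurableT IH).
by apply/seteqP; split => w; rewrite /preimage /= -iterSr => -[].
Qed.

Lemma integral_past n (f : n.-tuple X -> \bar R) :
  measurable_fun setT f ->
  \int[P]_w f (past n w) = \int[P]_w f (Xblock n w).
Proof.
apply: eq_integral_comp => [||A mA]; [exact: measurable_past|exact: measurable_Xblock|].
apply: etrans (esym (@stationary_iter n.+1 _ _)) _.
  by rewrite -[X in measurable X]setTI; exact: measurable_past.
by congr (P _); apply/seteqP; split => w; rewrite /preimage /= past_iter_shift.
Qed.

Lemma integral_past_with n (f : n.+1.-tuple X -> \bar R) :
  measurable_fun setT f ->
  \int[P]_w f (past_with n w (w 0%R)) = \int[P]_w f (Xblock n.+1 w).
Proof.
apply: (@eq_integral_comp _ _ _ _ _ P (fun w => past_with n w (w 0%R)) (@Xblock d X n.+1)).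
- exact: measurable_past_with0.
- exact: measurable_Xblock.
move=> A mA; apply: etrans (esym (@stationary_iter n.+1 _ _)) _.
  by rewrite -[X in measurable X]setTI; exact: measurable_past_with0.
by congr (P _); apply/seteqP; split => w; rewrite /preimage /=; rewrite past_with_iter_shift.
Qed.

End stationary_integrals.

End coordinates.

Lemma indic_preimage (T U : Type) (R : pzRingType) (f : T -> U) (A : set U) x :
  \1_(f @^-1` A) x = \1_A (f x) :> R.
Proof.
rewrite !indicE; suff -> : (x \in f @^-1` A) = (f x \in A) by [].
by apply/idP/idP; rewrite !inE.
Qed.

Section densities.
Context d (X : measurableType d) (R : realType).
Variable mu : {sigma_finite_measure set X -> \bar R}.
Local Notation seqspace := (@seqspace d X).
Local Open Scope ereal_scope.

Lemma integral_Xblock (Q : probability seqspace R) n (q : n.-tuple X -> R) f :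
  is_density mu Q q -> measurable_fun setT f -> (forall t, 0 <= f t) ->
  \int[Q]_w f (Xblock n w) = int_mu_pow mu (fun t => f t * (q t)%:E).
Proof.
move=> [q0 mq qQ] mf f0; have [m mE] := int_mu_pow_measure mu n.
have mX := @measurable_Xblock d X n.
pose nu : measure _ _ := pushforward_measure Q mX.
have := @ge0_integral_pushforward _ _ _ _ _ _ mX Q setT f measurableT mf (fun y _ => f0 y).
rewrite preimage_setT => <-.
rewrite -[LHS]/(\int[nu]_t f t) (@ge0_integral_density _ _ _ nu m q)// => [|A mA].
  rewrite mE// => [|t]; last by rewrite mule_ge0// lee_fin.
  by apply: emeasurable_funM => //; exact/measurable_EFinP.
rewrite -mE => [| |t]; first exact: qQ.
  by apply/measurable_EFinP/measurable_funM => //; exact: measurable_indic.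
by rewrite lee_fin mulr_ge0.
Qed.

Lemma eq_int_mu_pow n (f g : n.-tuple X -> \bar R) : f =1 g ->
  int_mu_pow mu f = int_mu_pow mu g.
Proof. by move=> /funext ->. Qed.

Lemma density_Xblock_gt0 (Q : probability seqspace R) n (q : n.-tuple X -> R) :
  is_density mu Q q -> {ae Q, forall w, (0 < q (Xblock n w))%R}.
Proof.
move=> dq; have [q0 mq qQ] := dq.
have mZ : measurable [set t | q t = 0%R].
  rewrite -[X in measurable X]setTI; exact: (mq measurableT [set 0%R]).
exists (Xblock n @^-1` [set t | q t = 0%R]); split.
- rewrite -[X in measurable X]setTI; exact: measurable_Xblock.
- rewrite qQ// (@eq_int_mu_pow _ _ (cst 0)).
    by have [m mE] := int_mu_pow_measure mu n; rewrite mE// integral0.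
  move=> t /=; rewrite indicE; case: (boolP (t \in _)) => [|_]; last by rewrite mul0r.
  by rewrite inE /= => ->; rewrite mulr0.
- move=> w /= /negP; rewrite -leNgt => qw; apply/eqP; rewrite eq_le qw; exact: q0.
Qed.

Section density_family.
Variables (Q : probability seqspace R) (r : forall n, n.-tuple X -> R).
Hypothesis dr : forall n, is_density mu Q (@r n).

Let r_ge0 n t : (0 <= @r n t)%R. Proof. by case: (dr n). Qed.
Let mr n : measurable_fun setT (@r n). Proof. by case: (dr n). Qed.

Let measurable_r_rcons n :
  measurable_fun setT (fun z : n.-tuple X * X => (r (rcons_tuple z.1 z.2))%:E).
Proof.
by apply/measurable_EFinP; exact: (measurableT_comp (@mr n.+1) (@measurable_rcons_tuple _ X n)).
Qed.

Lemma int_mu_pow_density n : int_mu_pow mu (fun t => (@r n t)%:E) = 1.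
Proof.
have [_ _ qQ] := dr n; have := qQ setT measurableT.
rewrite preimage_setT probability_setT => ->.
by apply: eq_int_mu_pow => t; rewrite indicE in_setT mul1r.
Qed.

(** The densities of different lengths are chosen separately, so they are consistent only almost
    everywhere. Both sides have the same integral over every measurable E, since the (n+1)-block
    determines whether the n-block lies in E. *)
Lemma density_marginal n (m : {measure set (n.-tuple X) -> \bar R}) :
  (forall f, measurable_fun setT f -> (forall t, 0 <= f t) ->
    int_mu_pow mu f = \int[m]_t f t) ->
  ae_eq m setT (fun t => (@r n t)%:E) (fun t => \int[mu]_x (r (rcons_tuple t x))%:E).
Proof.
move=> mE; have mrn : measurable_fun setT (fun t => (@r n t)%:E) by
  apply/measurable_EFinP; exact: mr.
have mg : measurable_fun setT (fun t : n.-tuple X => \int[mu]_x (r (rcons_tuple t x))%:E).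
  apply: (measurable_fun_fubini_tonelli_F (fun z => (r (rcons_tuple z.1 z.2))%:E)).
    exact: measurable_r_rcons.
  by move=> z; rewrite lee_fin.
apply: integral_ae_eq => //.
  apply/integrableP; split => //.
  under eq_integral do rewrite gee0_abs ?lee_fin//.
  rewrite -mE// => [|t]; last by rewrite lee_fin.
  by rewrite int_mu_pow_density ltry.
move=> E _ mE'.
have indE (f : n.-tuple X -> \bar R) t : (f \_ E) t = (\1_E t)%:E * f t.
  by rewrite patchE indicE; case: ifP; rewrite ?mul1e ?mul0e.
rewrite integral_mkcond [RHS]integral_mkcond.
under eq_integral do rewrite indE.
under [RHS]eq_integral do rewrite indE.
have mI : measurable_fun setT (fun t : n.-tuple X => (\1_E t : R)%:E).
  by apply/measurable_EFinP; exact: measurable_indic.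
rewrite -!mE; last 4 first.
- exact: emeasurable_funM.
- by move=> t; rewrite mule_ge0 ?integral_ge0 ?lee_fin// => *; rewrite lee_fin.
- exact: emeasurable_funM.
- by move=> t; rewrite mule_ge0 ?lee_fin.
have [_ _ qn] := dr n; have [_ _ qn1] := dr n.+1.
have := qn E mE'; rewrite (_ : _ @^-1` E = Xblock n.+1 @^-1` (@front d X n @^-1` E)); last first.
  by apply/seteqP; split => w; rewrite /preimage /= front_Xblock.
rewrite qn1; last first.
  by rewrite -[X in measurable X]setTI; exact: measurable_front.
move=> h; transitivity (int_mu_pow mu (fun t => (\1_E t * r t)%:E)).
  by apply: eq_int_mu_pow => t; rewrite EFinM.
rewrite -h int_mu_pow_rcons; apply: eq_int_mu_pow => t.
rewrite -ge0_integralZl//; last first.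
- by move=> x _; rewrite lee_fin.
- exact: (measurableT_comp (@measurable_r_rcons n) (pair1_measurable t)).
- by apply: eq_integral => x _; rewrite -EFinM indic_preimage front_rcons.
Qed.

End density_family.
End densities.

(** * Conditional densities under a stationary law *)

Section conditional_densities.
Context d (X : measurableType d) (R : realType).
Variable mu : {sigma_finite_measure set X -> \bar R}.
Local Notation seqspace := (@seqspace d X).
Local Open Scope ereal_scope.

(** The conditional density as a function of the tuple alone. It is 0 where the density of the past
    vanishes. *)
Definition cond_ratio (r : forall n, n.-tuple X -> R) n (t : n.+1.-tuple X) : R :=
  (r n.+1 t / r n (front t))%R.

Lemma cond_densE r n (w : seqspace) x : cond_dens r n w x = cond_ratio r (past_with n w x).
Proof. by rewrite /cond_dens /cond_ratio front_past_with. Qed.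

Section one_family.
Variables (Q : probability seqspace R) (r : forall n, n.-tuple X -> R).
Hypothesis dr : forall n, is_density mu Q (@r n).

Let r_ge0 n t : (0 <= @r n t)%R. Proof. by case: (dr n). Qed.
Let mr n : measurable_fun setT (@r n). Proof. by case: (dr n). Qed.

Lemma cond_ratio_ge0 n t : (0 <= @cond_ratio r n t)%R.
Proof. by rewrite divr_ge0. Qed.

Lemma measurable_cond_ratio n : measurable_fun setT (@cond_ratio r n).
Proof.
apply: measurable_divr_ge0 => //; first exact: mr.
exact: (measurableT_comp (@mr n) (@measurable_front _ X n)).
Qed.

Lemma measurable_cond_dens n :
  measurable_fun setT (fun z : seqspace * X => cond_dens r n z.1 z.2).
Proof.
rewrite (_ : (fun _ => _) = fun z : seqspace * X => cond_ratio r (past_with n z.1 z.2)).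
  exact: (measurableT_comp (@measurable_cond_ratio n) (@measurable_past_with _ X n)).
by apply/funext => z; rewrite cond_densE.
Qed.

Lemma cond_dens_ge0 n (w : seqspace) x : (0 <= cond_dens r n w x)%R.
Proof. by rewrite cond_densE cond_ratio_ge0. Qed.

End one_family.

Section two_families.
Variables (P Q : probability seqspace R) (p r : forall n, n.-tuple X -> R).
Hypothesis P_stat : stationary P.
Hypothesis dp : forall n, is_density mu P (@p n).
Hypothesis dr : forall n, is_density mu Q (@r n).

Let p_ge0 n t : (0 <= @p n t)%R. Proof. by case: (dp n). Qed.
Let r_ge0 n t : (0 <= @r n t)%R. Proof. by case: (dr n). Qed.
Let mp n : measurable_fun setT (@p n). Proof. by case: (dp n). Qed.
Let mr n : measurable_fun setT (@r n). Proof. by case: (dr n). Qed.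

(* The law of (past, X_0) has density [cond_dens p n] with respect to [P \x mu]
   on functions of the last [n] symbols and the present one. *)
Lemma integral_cond_dens n (g : n.+1.-tuple X -> \bar R) :
  measurable_fun setT g -> (forall t, 0 <= g t) ->
  \int[P \x mu]_z ((cond_dens p n z.1 z.2)%:E * g (past_with n z.1 z.2)) =
  \int[P]_w g (past_with n w (w 0%R)).
Proof.
move=> mg g0.
have mkE : measurable_fun setT (fun t => (@cond_ratio p n t)%:E).
  by apply/measurable_EFinP; exact: measurable_cond_ratio dp n.
have kE0 t : 0 <= (@cond_ratio p n t)%:E by rewrite lee_fin (cond_ratio_ge0 dp).
have mkg : measurable_fun setT (fun t => (@cond_ratio p n t)%:E * g t).
  exact: emeasurable_funM.
pose G t := \int[mu]_x ((cond_ratio p (rcons_tuple t x))%:E * g (rcons_tuple t x)).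
have mG : measurable_fun setT G.
  apply: (measurable_fun_fubini_tonelli_F (fun z : n.-tuple X * X =>
    (cond_ratio p (rcons_tuple z.1 z.2))%:E * g (rcons_tuple z.1 z.2))).
    exact: (measurableT_comp mkg (@measurable_rcons_tuple _ X n)).
  by move=> z; rewrite mule_ge0.
have G0 t : 0 <= G t by apply: integral_ge0 => x _; rewrite mule_ge0.
transitivity (\int[P]_w G (past n w)).
  rewrite fubini_tonelli1.
  - apply: eq_integral => w _; apply: eq_integral => x _ /=.
    by rewrite cond_densE past_with_rcons.
  - have := measurableT_comp mkg (@measurable_past_with _ X n).
    rewrite (_ : _ \o _ = fun z => (cond_dens p n z.1 z.2)%:E * g (past_with n z.1 z.2))//.
    by apply/funext => z /=; rewrite cond_densE.
  - by move=> z; rewrite mule_ge0// lee_fin (cond_dens_ge0 dp).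
rewrite (integral_past P_stat)// (integral_Xblock (dp n))//.
(* Multiplying the conditional density by the density of the past gives back p only where the latter
   is nonzero. [pos] records this condition, which holds almost surely under P. *)
pose pos t : \bar R := (p (@front _ X n t) != 0%R)%:R%:E.
have pos0 t : 0 <= pos t by rewrite lee_fin.
have mpos : measurable_fun setT pos.
  have mZ : measurable [set t | p (@front _ X n t) = 0%R].
    exact: (measurable_eq0 (measurableT_comp (@mp n) (@measurable_front _ X n))).
  rewrite (_ : pos = EFin \o \1_(~` [set t | p (@front _ X n t) = 0%R])).
    by apply/measurable_EFinP; apply: measurable_indic; exact: measurableC.
  apply/funext => t /=; rewrite /pos indicE; congr ((_ : bool)%:R%:E).
  by apply/idP/idP => [/eqP|]; rewrite inE//= => /eqP.
transitivity (int_mu_pow mu (fun t => (pos t * g t) * (p t)%:E)).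
  rewrite int_mu_pow_rcons; apply: eq_int_mu_pow => t; rewrite /G.
  rewrite -ge0_integralZr//; last 3 first.
  - exact: (measurableT_comp mkg (measurableT_comp (@measurable_rcons_tuple _ X n) (pair1_measurable t))).
  - by move=> x _; rewrite mule_ge0.
  - by rewrite lee_fin.
  apply: eq_integral => x _; rewrite /pos /cond_ratio front_rcons.
  rewrite [LHS]muleAC [RHS]muleAC -!EFinM; congr (_%:E * _).
  by have [->|pt0] := eqVneq (p t) 0%R; rewrite ?mulr0 ?mul0r// divfK// mul1r.
rewrite -(integral_Xblock (f := fun t => pos t * g t) (dp n.+1)).
- rewrite (integral_past_with P_stat)//.
  apply: ge0_ae_eq_integral => //.
  + exact: (measurableT_comp (emeasurable_funM mpos mg) (@measurable_Xblock _ X n.+1)).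
  + exact: (measurableT_comp mg (@measurable_Xblock _ X n.+1)).
  + by move=> w _; rewrite mule_ge0.
  + apply: filterS (density_Xblock_gt0 (dp n)) => w pw _.
    by rewrite /pos front_Xblock gt_eqF//= mul1e.
- exact: emeasurable_funM.
- by move=> t; rewrite mule_ge0.
Qed.

(** For almost every past the integral over x is 1 if r_n is positive there and 0 otherwise. This is
    a statement about mu^n, and it passes to P because P_n has a density. *)
Lemma integral_cond_dens_le1 n :
  \int[P \x mu]_z (cond_dens r n z.1 z.2)%:E <= 1.
Proof.
have mk : measurable_fun setT (fun t => (@cond_ratio r n t)%:E).
  by apply/measurable_EFinP; exact: measurable_cond_ratio dr n.
have k0 t : 0 <= (@cond_ratio r n t)%:E by rewrite lee_fin (cond_ratio_ge0 dr).
pose G (t : n.-tuple X) := \int[mu]_x (cond_ratio r (rcons_tuple t x))%:E.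
have mG : measurable_fun setT G.
  apply: (measurable_fun_fubini_tonelli_F (fun z : n.-tuple X * X =>
    (cond_ratio r (rcons_tuple z.1 z.2))%:E)) => //.
  exact: (measurableT_comp mk (@measurable_rcons_tuple _ X n)).
have G0 t : 0 <= G t by apply: integral_ge0 => x _.
rewrite fubini_tonelli1; last 2 first.
- by apply/measurable_EFinP; exact: measurable_cond_dens dr n.
- by move=> z; rewrite lee_fin (cond_dens_ge0 dr).
rewrite (_ : \int[P]_w _ = \int[P]_w G (past n w)); last first.
  apply: eq_integral => w _; apply: eq_integral => x _ /=.
  by rewrite cond_densE past_with_rcons.
rewrite (integral_past P_stat)// (integral_Xblock (dp n))//.
have [m mE] := int_mu_pow_measure mu n.
rewrite -(int_mu_pow_density dp n) !mE; last 4 first.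
- by apply/measurable_EFinP; exact: mp.
- by move=> t; rewrite lee_fin.
- by apply: emeasurable_funM => //; apply/measurable_EFinP; exact: mp.
- by move=> t; rewrite mule_ge0 ?lee_fin.
apply: ae_ge0_le_integral => //.
- by move=> t _; rewrite mule_ge0 ?lee_fin.
- by apply: emeasurable_funM => //; apply/measurable_EFinP; exact: mp.
- by move=> t _; rewrite lee_fin.
- by apply/measurable_EFinP; exact: mp.
apply: filterS (density_marginal dr mE) => t /(_ I) h _.
rewrite -[leRHS]mul1e; apply: lee_wpmul2r; first by rewrite lee_fin.
rewrite /G; under eq_integral do rewrite /cond_ratio front_rcons EFinM.
rewrite ge0_integralZr//; last 3 first.
- apply/measurable_EFinP.
  exact: (measurableT_comp (@mr n.+1) (measurableT_comp (@measurable_rcons_tuple _ X n) (pair1_measurable t))).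
- by move=> x _; rewrite lee_fin.
- by rewrite lee_fin invr_ge0.
rewrite -h -EFinM lee_fin.
by have [->|rt0] := eqVneq (r t) 0%R; rewrite ?mul0r// divff.
Qed.

(* P_{n+1} << mu^{n+1}, and Q almost surely does not visit the zeros of r_n. *)
Lemma density_support n :
  {ae P, forall w, (0 < r (Xblock n.+1 w))%R -> (0 < r (Xblock n w))%R}.
Proof.
pose B := [set t : n.+1.-tuple X | (0 < r t)%R /\ r (front t) = 0%R].
have mB : measurable B.
  have m1 : measurable [set t : n.+1.-tuple X | (0 < r t)%R].
    exact: measurable_gt0 (@mr n.+1).
  have m2 : measurable [set t : n.+1.-tuple X | r (front t) = 0%R].
    exact: (measurable_eq0 (measurableT_comp (@mr n) (@measurable_front _ X n))).
  exact: measurableI.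
have [m mE] := int_mu_pow_measure mu n.+1.
have mBf (q : n.+1.-tuple X -> R) : measurable_fun setT q -> measurable_fun setT (fun t => (\1_B t * q t)%:E).
  by move=> mq; apply/measurable_EFinP; apply: measurable_funM => //; exact: measurable_indic.
have Q0 : Q (Xblock n.+1 @^-1` B) = 0.
  apply: measure_negligible; first by rewrite -[X in measurable X]setTI; exact: measurable_Xblock.
  apply: negligibleS (density_Xblock_gt0 (dr n)) => w /= [_] e.
  by rewrite front_Xblock in e; rewrite e ltxx.
have [_ _ qr] := dr n.+1; rewrite qr// mE in Q0; last 2 first.
- exact: mBf.
- by move=> t; rewrite lee_fin mulr_ge0.
(* The density r is positive on B while its integral over B is 0. *)
have mB0 : m B = 0.
  apply: measure_negligible => //.
  have /ae_eq_integral_abs : \int[m]_t `|(\1_B t * r t)%:E| = 0.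
    by rewrite -[RHS]Q0; apply: eq_integral => t _; rewrite gee0_abs// lee_fin mulr_ge0.
  move=> /(_ measurableT (mBf _ (@mr n.+1))) h.
  apply: negligibleS h => t Bt /= /(_ I) [].
  rewrite indicE mem_set// mul1r; case: Bt => + _ => /[swap] ->.
  by rewrite ltxx.
exists (Xblock n.+1 @^-1` B); split.
- by rewrite -[X in measurable X]setTI; exact: measurable_Xblock.
- have [_ _ ->//] := dp n.+1; rewrite mE; last 2 first.
  + exact: mBf.
  + by move=> t; rewrite lee_fin mulr_ge0.
  rewrite -(@integral0 _ _ _ m setT); apply: ge0_ae_eq_integral => //.
  + exact: mBf.
  + by move=> t _; rewrite lee_fin mulr_ge0.
  exists B; split=> // t /= h; apply: contrapT => Bt; apply: h => _.
  by rewrite indicE memNset// mul0r.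
move=> w /= /not_implyP [rw /negP]; rewrite -leNgt => rw0; split => //.
by rewrite front_Xblock; apply/eqP; rewrite eq_le rw0 r_ge0.
Qed.

End two_families.
End conditional_densities.

Lemma ae_le_integral_EFin d (T : measurableType d) (R : realType)
    (m : {measure set T -> \bar R}) (f g : T -> R) :
  m.-integrable setT (fun x => (f x)%:E) -> m.-integrable setT (fun x => (g x)%:E) ->
  {ae m, forall x, f x <= g x} -> (\int[m]_x (f x)%:E <= \int[m]_x (g x)%:E)%E.
Proof.
move=> fi gi fg; have hi := integrableB measurableT gi fi.
rewrite -sube_ge0 ?integrable_fin_num// -integralB//.
rewrite (ae_eq_integral (fun x => `|(g x)%:E - (f x)%:E|%E))//.
- exact: integral_ge0.
- exact: measurable_int hi.
- by apply: measurableT_comp => //; exact: measurable_int hi.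
- by apply: filterS fg => x fgx _; rewrite gee0_abs// -EFinB lee_fin subr_ge0.
Qed.

(** * Functions of a finite past and the present symbol *)

Section adapted.
Context d (X : measurableType d) (R : realType).
Local Notation seqspace := (@seqspace d X).

(** Measurability with respect to (X_{-n:-1}, x), stated as a factorization so that stationarity can
    be applied to the factor [g]. *)
Definition adapted n (c : seqspace -> X -> R) : Prop :=
  exists2 g : n.+1.-tuple X -> R, measurable_fun setT g &
    forall w x, c w x = g (past_with n w x).

Lemma adapted_measurable n c : adapted n c ->
  measurable_fun setT (fun z : seqspace * X => c z.1 z.2).
Proof.
move=> [g mg cg]; rewrite (_ : (fun _ => _) = fun z : seqspace * X => g (past_with n z.1 z.2)).
  exact: (measurableT_comp mg (@measurable_past_with _ X n)).
by apply/funext => z; rewrite cg.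
Qed.

Lemma adapted_measurable0 n c : adapted n c ->
  measurable_fun setT (fun w : seqspace => c w (w 0)).
Proof.
by move=> /adapted_measurable mc; exact: (measurableT_comp mc (@measurable_graph_at0 d X)).
Qed.

Lemma adapted_le m n c : (m <= n)%N -> adapted m c -> adapted n c.
Proof.
elim: n => [|n IH]; first by rewrite leqn0 => /eqP ->.
rewrite leq_eqVlt => /predU1P[->//|]; rewrite ltnS => /IH{}IH /IH[g mg cg].
exists (fun t : n.+2.-tuple X => g [tuple of behead t]).
  exact: (measurableT_comp mg (@measurable_behead _ X n.+1)).
by move=> w x; rewrite behead_past_with.
Qed.

Lemma adapted_cond_dens (mu : {sigma_finite_measure set X -> \bar R}) (Q : probability seqspace R) (r : forall n, n.-tuple X -> R) n :
  (forall n, is_density mu Q (@r n)) -> adapted n (cond_dens r n).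
Proof.
move=> dr; exists (@cond_ratio _ X R r n); last by move=> w x; rewrite cond_densE.
exact: measurable_cond_ratio dr n.
Qed.

Lemma adapted_cesaro (mu : {sigma_finite_measure set X -> \bar R}) (Q : probability seqspace R) (r : forall n, n.-tuple X -> R) n m :
  (forall n, is_density mu Q (@r n)) -> (n <= m)%N -> adapted m (Defs.cesaro r n).
Proof.
move=> dr nm; have ad (i : 'I_n) : adapted m (cond_dens r i).
  apply: adapted_le (adapted_cond_dens i dr).
  exact: leq_trans (ltnW (ltn_ord i)) nm.
pose g i := s2val (cid2 (ad i)).
exists (fun t => n%:R^-1 * \sum_(i < n) g i t) => [|w x].
  apply: measurable_funM => //; apply: measurable_sum => i.
  exact: (s2valP (cid2 (ad i))).
by rewrite /Defs.cesaro; congr (_ * _); apply: eq_bigr => i _; exact: (s2valP' (cid2 (ad i))).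
Qed.

End adapted.

(** * Convergence, change of measure and Gibbs' inequality *)

Section stationary_density.
Context d (X : measurableType d) (R : realType).
Variable mu : {sigma_finite_measure set X -> \bar R}.
Local Notation seqspace := (@seqspace d X).
Variables (P : probability seqspace R) (p : forall n, n.-tuple X -> R).
Hypothesis P_stat : stationary P.
Hypothesis dp : forall n, is_density mu P (@p n).
Local Open Scope ereal_scope.

Let M_ge0 n (w : seqspace) x : (0 <= cond_dens p n w x)%R.
Proof. exact: cond_dens_ge0 dp n w x. Qed.

(** N is the law of (w, X_0), carried by the graph of the coordinate at 0, and [F j] consists of the
    events in j past symbols and x. On [F j] the density of N is the conditional density, by
    [integral_cond_dens]. *)
Lemma ae_cvg_cond_dens :
  {ae P \x mu, forall z, cvgn (fun n => (cond_dens p n z.1 z.2)%:E)}.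
Proof.
pose N : measure _ _ := pushforward_measure P (@measurable_graph_at0 d X).
pose F j : set (set (seqspace * X)) := [set A | exists2 B, measurable B &
  A = (fun z => past_with j z.1 z.2) @^-1` B].
apply: (@likelihood_ratio_ae_cvg _ _ _ (P \x mu) N (fun n z => cond_dens p n z.1 z.2) F).
- move=> j _ [B mB ->]; rewrite -[X in measurable X]setTI.
  exact: (@measurable_past_with _ X j measurableT B mB).
- by move=> j; exists setT.
- by move=> j _ [B mB ->]; exists (~` B) => //; exact: measurableC.
- by move=> j _ _ [B mB ->] [C mC ->]; exists (B `&` C) => //; exact: measurableI.
- move=> j _ [B mB ->]; exists ((fun t : j.+2.-tuple X => [tuple of behead t]) @^-1` B).
    rewrite -[X in measurable X]setTI.
    exact: (@measurable_behead _ X j.+1 measurableT B mB).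
  by apply/seteqP; split => z; rewrite /preimage /= behead_past_with.
- move=> j a; exists [set t | (0 < a - @cond_ratio _ X R p j t)%R].
    apply: measurable_gt0; apply: measurable_funB => //.
    exact: measurable_cond_ratio dp j.
  by apply/seteqP; split => z; rewrite /preimage /= cond_densE subr_gt0.
- move=> j b; exists [set t | (0 < @cond_ratio _ X R p j t - b)%R].
    apply: measurable_gt0; apply: measurable_funB => //.
    exact: measurable_cond_ratio dp j.
  by apply/seteqP; split => z; rewrite /preimage /= cond_densE subr_gt0.
- move=> j _ [B mB ->].
  have mI : measurable_fun setT (fun t : j.+1.-tuple X => (\1_B t : R)%:E).
    by apply/measurable_EFinP; exact: measurable_indic.
  have mP : measurable ((fun w : seqspace => past_with j w (w 0%R)) @^-1` B).
    rewrite -[X in measurable X]setTI.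
    exact: (@measurable_past_with0 _ X j measurableT B mB).
  rewrite integral_mkcond.
  transitivity (\int[P]_w (\1_B (past_with j w (w 0%R)))%:E).
    under eq_integral do rewrite -(indic_preimage R (fun w : seqspace => past_with j w (w 0%R))).
    by rewrite integral_indic// setIT.
  rewrite -(integral_cond_dens P_stat dp mI) => [|t]; last by rewrite lee_fin.
  apply: eq_integral => z _; rewrite patchE.
  have -> : (z \in (fun z : seqspace * X => past_with j z.1 z.2) @^-1` B) =
    (past_with j z.1 z.2 \in B) by apply/idP/idP; rewrite !inE.
  by rewrite indicE; case: ifP; rewrite ?mule1 ?mule0.
- by move=> j z; exact: M_ge0.
- by rewrite -[X in X <= _]/(P setT) probability_setT.
Qed.

Lemma integral_adapted0 m c : adapted m c -> (forall w x, 0 <= c w x)%R ->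
  \int[P \x mu]_z (cond_dens p m z.1 z.2 * c z.1 z.2)%:E = \int[P]_w (c w (w 0%R))%:E.
Proof.
move=> [g mg cg] c0.
(* [g] is only known to be nonnegative on the range of [past_with m] *)
pose g' t := `|(g t)%:E|.
have mg' : measurable_fun setT g' by apply: measurableT_comp => //; exact/measurable_EFinP.
have c_g w x : (c w x)%:E = g' (past_with m w x) by rewrite /g' -cg gee0_abs// lee_fin.
under [RHS]eq_integral do rewrite c_g.
rewrite -(integral_cond_dens P_stat dp mg') => [|t]; last exact: abse_ge0.
by apply: eq_integral => z _; rewrite -c_g EFinM.
Qed.

(** The test function is the indicator of the zeros of M_m: its product with M_m vanishes, so its
    expectation at X_0 is 0. *)
Lemma cond_dens_at0_gt0 m : {ae P, forall w, (0 < cond_dens p m w (w 0%R))%R}.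
Proof.
pose c w x : R := (cond_dens p m w x == 0)%R%:R.
have ac : adapted m c.
  exists (fun t => (@cond_ratio _ X R p m t == 0)%R%:R).
    rewrite (_ : (fun _ => _) = \1_[set t | @cond_ratio _ X R p m t = 0%R]).
      by apply: measurable_indic; apply: measurable_eq0; exact: measurable_cond_ratio dp m.
    by apply/funext => t; rewrite indicE; congr ((_ : bool)%:R); apply/idP/idP => [/eqP|]; rewrite inE//= => ->.
  by move=> w x; rewrite /c cond_densE.
have mc0 := adapted_measurable0 ac.
have : \int[P]_w (c w (w 0%R))%:E = 0.
  rewrite -(integral_adapted0 ac) => [|w x]; last by rewrite ler0n.
  rewrite -(@integral0 _ _ _ (P \x mu) setT); apply: eq_integral => z _.
  by rewrite /c; case: eqP => [->|_]; rewrite ?mul0r ?mulr0.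
move=> h; have {}h : \int[P]_w `|(c w (w 0%R))%:E| = 0.
  by rewrite -[RHS]h; apply: eq_integral => w _; rewrite gee0_abs// lee_fin ler0n.
have := (ae_eq_integral_abs P measurableT (f := fun w => (c w (w 0%R))%:E)).
move=> /(_ _)[]; first exact/measurable_EFinP.
move=> /(_ h) + _; apply: filterS => w /(_ I) /=; rewrite /c lt0r M_ge0 andbT.
by case: eqP => // _ [] /eqP; rewrite oner_eq0.
Qed.

(** The change of measure multiplies c / M_m by M_m, which restores c except at the zeros of M_m,
    where the quotient is 0. *)
Lemma integral_ratio0 m c : adapted m c -> (forall w x, 0 <= c w x)%R ->
  \int[P]_w (c w (w 0%R) / cond_dens p m w (w 0%R))%:E =
  \int[P \x mu]_z (c z.1 z.2 * (cond_dens p m z.1 z.2 != 0)%R%:R)%:E.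
Proof.
move=> [g mg cg] c0.
have ar : adapted m (fun w x => c w x / cond_dens p m w x)%R.
  exists (fun t => g t / @cond_ratio _ X R p m t)%R.
    apply: measurable_divr_ge0 => //; first exact: measurable_cond_ratio dp m.
    exact: cond_ratio_ge0 dp m.
  by move=> w x; rewrite cg cond_densE.
rewrite -(integral_adapted0 ar) => [|w x]; last by rewrite divr_ge0.
apply: eq_integral => z _; congr EFin.
by have [->|h] := eqVneq (cond_dens p m z.1 z.2) 0%R; rewrite ?mul0r ?mulr0// mulrC divfK// mulr1.
Qed.

Lemma integral_ratio0_le m c : adapted m c -> (forall w x, 0 <= c w x)%R ->
  \int[P]_w (c w (w 0%R) / cond_dens p m w (w 0%R))%:E <= \int[P \x mu]_z (c z.1 z.2)%:E.
Proof.
move=> ac c0; rewrite integral_ratio0//.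
have mc := adapted_measurable ac.
have mM := adapted_measurable (adapted_cond_dens m dp).
apply: ge0_le_integral => //.
- by move=> z _; rewrite lee_fin mulr_ge0.
- apply/measurable_EFinP; apply: measurable_funM => //.
  rewrite (_ : (fun _ => _) = \1_(~` [set z : seqspace * X | cond_dens p m z.1 z.2 = 0%R])).
    by apply: measurable_indic; apply: measurableC; exact: measurable_eq0.
  apply/funext => z; rewrite indicE; congr ((_ : bool)%:R).
  by apply/idP/idP => [/eqP|]; rewrite inE//= => /eqP.
- exact/measurable_EFinP.
- by move=> z _; rewrite lee_fin; case: eqP; rewrite ?mulr0 ?mulr1.
Qed.

(** ln t <= t - 1 at t = b / a. Gibbs' inequality, the concavity bound for means and the sign of the
    Bregman integrand all come from it. *)
Lemma ln_le_ratio (a b : R) : (0 < a -> 0 < b -> ln b <= ln a + b / a - 1)%R.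
Proof.
move=> a0 b0; have ba0 : (0 < b / a)%R by rewrite divr_gt0.
have : (ln (1 + (b / a - 1)) <= b / a - 1)%R by apply: le_ln1Dx; lra.
by rewrite (_ : 1 + _ = b / a)%R ?ln_div ?posrE//; lra.
Qed.

(** The positive part of ln c is at most that of ln M_m plus c / M_m, and the expectation of the
    quotient is at most the integral of c. This excludes indeterminate differences of infinities. *)
Lemma integral_ln_pos_lty m c : adapted m c -> (forall w x, 0 <= c w x)%R ->
  \int[P \x mu]_z (c z.1 z.2)%:E < +oo ->
  \int[P]_w (Num.max (ln (cond_dens p m w (w 0%R))) 0)%:E < +oo ->
  \int[P]_w (Num.max (ln (c w (w 0%R))) 0)%:E < +oo.
Proof.
move=> ac c0 cfin Mfin.
have mc0 := adapted_measurable0 ac.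
have mM0 := adapted_measurable0 (adapted_cond_dens m dp).
have mln (f : seqspace -> R) : measurable_fun setT f ->
    measurable_fun setT (fun w => (Num.max (ln (f w)) 0)%:E).
  move=> mf; apply/measurable_EFinP; apply: measurable_maxr => //.
  exact: (measurableT_comp (@measurable_ln R) mf).
have mr : measurable_fun setT (fun w : seqspace => (c w (w 0%R) / cond_dens p m w (w 0%R))%:E).
  by apply/measurable_EFinP; exact: measurable_divr_ge0.
apply: (@le_lt_trans _ _ (\int[P]_w ((Num.max (ln (cond_dens p m w (w 0%R))) 0)%:E
   + (c w (w 0%R) / cond_dens p m w (w 0%R))%:E))).
  apply: ae_ge0_le_integral => //.
  - by move=> w _; rewrite lee_fin le_max lexx orbT.
  - exact: mln.
  - move=> w _; apply: adde_ge0; rewrite lee_fin; last exact: divr_ge0.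
    by rewrite le_max lexx orbT.
  - by apply: emeasurable_funD => //; exact: mln.
  apply: filterS (cond_dens_at0_gt0 m) => w M0 _.
  rewrite -EFinD lee_fin.
  have x0 : (0 <= Num.max (ln (cond_dens p m w (w 0))) 0)%R by rewrite le_max lexx orbT.
  have xM : (ln (cond_dens p m w (w 0)) <= Num.max (ln (cond_dens p m w (w 0))) 0)%R.
    by rewrite le_max lexx.
  have cM0 : (0 <= c w (w 0) / cond_dens p m w (w 0))%R by rewrite divr_ge0.
  rewrite ge_max addr_ge0// andbT.
  have [cw|cw] := ltP 0%R (c w (w 0%R)); last by rewrite ln0// addr_ge0.
  by have := ln_le_ratio M0 cw; lra.
rewrite ge0_integralD//; last 3 first.
- by move=> w _; rewrite lee_fin le_max lexx orbT.
- exact: mln.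
- by move=> w _; rewrite lee_fin divr_ge0.
by rewrite lte_add_pinfty// (le_lt_trans (integral_ratio0_le ac c0)).
Qed.

Lemma gibbs m c : adapted m c -> (forall w x, 0 <= c w x)%R ->
  {ae P, forall w, (0 < c w (w 0%R))%R} -> \int[P \x mu]_z (c z.1 z.2)%:E <= 1 ->
  P.-integrable setT (fun w => (ln (cond_dens p m w (w 0%R)))%:E) ->
  P.-integrable setT (fun w => (ln (c w (w 0%R)))%:E) ->
  \int[P]_w (ln (c w (w 0%R)))%:E <= \int[P]_w (ln (cond_dens p m w (w 0%R)))%:E.
Proof.
move=> ac c0 cpos cle1 iM ic.
have mc0 := adapted_measurable0 ac.
have mM0 := adapted_measurable0 (adapted_cond_dens m dp).
pose q w : R := (c w (w 0%R) / cond_dens p m w (w 0%R))%R.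
have q0 w : (0 <= q w)%R by rewrite divr_ge0.
have mq : measurable_fun setT q by exact: measurable_divr_ge0.
have q1 : \int[P]_w (q w)%:E <= 1 by exact: le_trans (integral_ratio0_le ac c0) cle1.
have iq : P.-integrable setT (fun w => (q w)%:E).
  apply/integrableP; split; first exact/measurable_EFinP.
  under eq_integral do rewrite gee0_abs ?lee_fin//.
  by rewrite (le_lt_trans q1)// ltry.
have i1 : P.-integrable setT (fun=> 1%:E) by exact: finite_measure_integrable_cst.
have iMq := integrableD measurableT iM iq.
have int1 : \int[P]_w (1:R)%:E = 1.
  by rewrite (integral_cst P measurableT 1%:E) mul1e; exact: probability_setT.
have iMq1 := integrableB measurableT iMq i1.
apply: (@le_trans _ _ (\int[P]_w (ln (cond_dens p m w (w 0%R)) + q w - 1)%:E)).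
  apply: ae_le_integral_EFin => //.
  by apply: filterS2 cpos (cond_dens_at0_gt0 m) => w cw Mw; exact: ln_le_ratio.
under eq_integral do rewrite EFinB EFinD.
rewrite integralB// integralD// int1.
by rewrite -[leRHS]adde0 -addeA leeD2lE ?integrable_fin_num// lee_subel_addr// add0e.
Qed.

End stationary_density.

(** * Entropy rate *)

Lemma measurable_lne (R : realType) : measurable_fun setT (@lne R).
Proof.
rewrite (_ : @lne R = fun x => if (x <= 0)%E then -oo%E else
  if x == +oo%E then +oo%E else (ln (fine x))%:E); last first.
  by apply/funext => -[r| |] //=; rewrite leNye.
have mle : measurable_fun setT (fun x : \bar R => (x <= 0)%E) by exact: measurable_fun_lee.
have moo : measurable_fun setT (fun x : \bar R => x == +oo%E) by exact: measurable_fun_eqe.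
have mfin : measurable_fun setT (fun x : \bar R => (ln (fine x))%:E).
  apply/measurable_EFinP; apply: (measurableT_comp (@measurable_ln R)).
  exact: fine_measurable.
have m2 := measurable_fun_ifT moo (@measurable_cst _ _ _ _ setT (+oo%E : \bar R)) mfin.
exact: (measurable_fun_ifT mle (@measurable_cst _ _ _ _ setT (-oo%E : \bar R)) m2).
Qed.

(** From index m on, every increment of e is at least c m, so the limit - h of e k / k is at least c
    m. *)
Lemma cvg_average_le (R : realType) (e c : nat -> R) (h : R) N :
  (forall k, (N <= k)%N -> e k.+1 = e k + c k) ->
  (forall k, (N <= k)%N -> c k <= c k.+1) ->
  (- e k / k%:R) @[k --> \oo] --> h -> forall m, (N <= m)%N -> c m <= - h.
Proof.
move=> ec cc eh m Nm.
have cm k : (m <= k)%N -> c m <= c k.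
  elim: k => [|k IH]; first by rewrite leqn0 => /eqP ->.
  rewrite leq_eqVlt => /predU1P[->//|]; rewrite ltnS => mk.
  by rewrite (le_trans (IH mk))// cc// (leq_trans Nm).
have em j : e m + j%:R * c m <= e (m + j)%N.
  elim: j => [|j IH]; first by rewrite mul0r addr0 addn0.
  rewrite addnS ec ?(leq_trans Nm) ?leq_addr// -natr1 mulrDl mul1r addrA.
  by rewrite lerD// cm// leq_addr.
rewrite leNgt; apply/negP => hc.
(* Half of the supposed gap: one half absorbs the error in the limit, the other must beat the
   constant [K] left by the first m terms. *)
pose del := (c m + h) / 2; have del0 : 0 < del by rewrite /del; lra.
have [n1 _ n1P] : \forall k \near \oo, h - del < - e k / k%:R.
  by apply: (cvgr_gt h eh); rewrite ltrBlDr ltrDl.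
pose K := `|m%:R * c m - e m|.
pose k := maxn (maxn n1 m.+1) (Num.truncn (K / del)).+1.
have kn1 : (n1 <= k)%N by rewrite /k; lia.
have mk : (m < k)%N by rewrite /k; lia.
have k0 : 0 < k%:R :> R by rewrite ltr0n; lia.
have Kk : K < del * k%:R.
  rewrite mulrC -ltr_pdivrMr//; apply: lt_le_trans (truncnS_gt _) _.
  by rewrite ler_nat /k leq_maxr.
have := n1P k kn1; rewrite /= ltr_pdivlMr// => h1.
have h2 : e m + (k%:R - m%:R) * c m <= e k.
  by have := em (k - m)%N; rewrite natrB ?subnKC// ltnW.
have h3 : m%:R * c m - e m <= K by exact: ler_norm.
have : (c m + h - del) * k%:R <= K by nra.
have -> : c m + h - del = del by rewrite /del; field.
by move=> h4; lra.
Qed.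

Section entropy.
Context d (X : measurableType d) (R : realType).
Variable mu : {sigma_finite_measure set X -> \bar R}.
Local Notation seqspace := (@seqspace d X).
Variables (P : probability seqspace R) (p : forall n, n.-tuple X -> R) (h : R).
Hypothesis P_stat : stationary P.
Hypothesis dp : forall n, is_density mu P (@p n).
Local Open Scope ereal_scope.

Section transfer.
Variables (Q : probability seqspace R) (r : forall n, n.-tuple X -> R).
Hypothesis dr : forall n, is_density mu Q (@r n).

Lemma integral_cond_dens0 k (phi : R -> \bar R) : measurable_fun setT phi ->
  \int[P]_w phi (cond_dens r k w (w 0%R)) =
  \int[P]_w phi (r (Xblock k.+1 w) / r (Xblock k w))%R.
Proof.
move=> mphi; under eq_integral do rewrite cond_densE.
under [RHS]eq_integral do rewrite -(front_Xblock k).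
apply: (integral_past_with P_stat (f := fun t => phi (@cond_ratio _ X R r k t))).
have mk : measurable_fun setT (@cond_ratio _ X R r k) by exact: measurable_cond_ratio dr k.
exact: (measurableT_comp mphi mk).
Qed.

Lemma measurable_density n : measurable_fun setT (fun w : seqspace => r (Xblock n w)).
Proof. by have [_ mr _] := dr n; exact: (measurableT_comp mr (@measurable_Xblock _ X n)). Qed.

Lemma measurable_density_ratio n :
  measurable_fun setT (fun w : seqspace => r (Xblock n.+1 w) / r (Xblock n w))%R.
Proof. by apply: measurable_divr_ge0 => [||w]; [exact: measurable_density..|case: (dr n)]. Qed.

Lemma integrable_cond_dens0 k (phi : R -> \bar R) : measurable_fun setT phi ->
  P.-integrable setT (fun w => phi (r (Xblock k.+1 w) / r (Xblock k w))%R) <->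
  P.-integrable setT (fun w => phi (cond_dens r k w (w 0%R))).
Proof.
move=> mphi; have mc := adapted_measurable0 (adapted_cond_dens k dr).
have e := integral_cond_dens0 k (phi := fun x => `|phi x|) (measurableT_comp (@abse_measurable R setT) mphi).
split=> /integrableP[_ fin]; apply/integrableP; split.
- exact: (measurableT_comp mphi mc).
- by rewrite e.
- exact: (measurableT_comp mphi (measurable_density_ratio k)).
- by rewrite -e.
Qed.

End transfer.

Let mlnE : measurable_fun setT (fun x : R => (ln x)%:E).
Proof. by apply/measurable_EFinP; exact: measurable_ln. Qed.

Let log_dens k w : R := ln (p (Xblock k w)).

Let log_densE k : {ae P, forall w,
  ln (p (Xblock k.+1 w) / p (Xblock k w)) = (log_dens k.+1 w - log_dens k w)%R}.
Proof.
apply: filterS2 (density_Xblock_gt0 (dp k)) (density_Xblock_gt0 (dp k.+1)) => w p0 p1.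
by rewrite ln_div.
Qed.

Lemma integrable_log_cond_dens k :
  P.-integrable setT (EFin \o log_dens k) -> P.-integrable setT (EFin \o log_dens k.+1) ->
  P.-integrable setT (fun w => (ln (cond_dens p k w (w 0%R)))%:E) /\
  \int[P]_w (log_dens k.+1 w)%:E =
    \int[P]_w (log_dens k w)%:E + \int[P]_w (ln (cond_dens p k w (w 0%R)))%:E.
Proof.
move=> ik ik1; have iB := integrableB measurableT ik1 ik.
have mr : measurable_fun setT (fun w => (ln (p (Xblock k.+1 w) / p (Xblock k w)))%:E).
  exact: (measurableT_comp mlnE (measurable_density_ratio dp k)).
have ae : ae_eq P setT (fun w => (ln (p (Xblock k.+1 w) / p (Xblock k w)))%:E)
    ((EFin \o log_dens k.+1) \- (EFin \o log_dens k)).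
  by apply: filterS (log_densE k) => w -> _.
split.
  apply/(integrable_cond_dens0 dp k mlnE); apply/integrableP; split => //.
  have /integrableP[mB] := iB; apply: le_lt_trans.
  rewrite (ae_eq_integral _ _ _ _ _ (ae_eq_abse ae))//; exact: measurableT_comp.
rewrite (integral_cond_dens0 dp k mlnE) (ae_eq_integral _ _ _ _ _ ae)//; last first.
  exact: measurable_int iB.
rewrite integralB// addeC subeK//; exact: integrable_fin_num.
Qed.

Hypothesis P_h : (fun n => (\int[P]_w (- lne (p (Xblock n w))%:E)) * (n%:R^-1)%:E)
  @ \oo --> h%:E.

(** Convergence to a real number forces the extended expectations to be finite from some index on,
    and a finite integral means integrability. *)
Lemma integrable_log_dens : exists2 N, (0 < N)%N & forall k, (N <= k)%N ->
  P.-integrable setT (EFin \o log_dens k) /\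
  \int[P]_w (- lne (p (Xblock k w))%:E) = - \int[P]_w (log_dens k w)%:E.
Proof.
have /fine_cvgP[[N _ NP] _] := P_h.
(* Index 0 is avoided: there the factor 1 / k is 0 and would hide an infinite integral. *)
exists N.+1 => // k Nk; have := NP k (ltnW Nk).
have m1 : measurable_fun setT (fun w => - lne (p (Xblock k w))%:E).
  apply: measurableT_comp => //; apply: (measurableT_comp (@measurable_lne R)).
  by apply/measurable_EFinP; exact: measurable_density dp k.
have m2 : measurable_fun setT (log_dens k).
  exact: (measurableT_comp (@measurable_ln R) (measurable_density dp k)).
have e : \int[P]_w (- lne (p (Xblock k w))%:E) = \int[P]_w (- log_dens k w)%:E.
  apply: ae_eq_integral => //; first by apply/measurable_EFinP; exact: measurable_funN.
  by apply: filterS (density_Xblock_gt0 (dp k)) => w p0 _; rewrite lne_EFin.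
rewrite /= e => fin.
have {}fin : \int[P]_w (- log_dens k w)%:E \is a fin_num.
  move: fin; have : (0 < k%:R^-1 :> R)%R by rewrite invr_gt0 ltr0n; lia.
  move=> k0; case: (\int[P]_w _) => //; rewrite ?gt0_mulye ?gt0_mulNye ?lte_fin//.
move: fin; rewrite -integral_fin_num_abs//; last exact: measurable_funN.
move=> fin; have ik : P.-integrable setT (EFin \o log_dens k).
  apply/integrableP; split; first exact/measurable_EFinP.
  by move: fin; under eq_integral do rewrite EFinN abseN.
split => //; rewrite -(integralN (f := EFin \o log_dens k))//.
by rewrite integrable_add_def.
Qed.

Lemma integral_log_cond_dens_le : exists N, forall m, (N <= m)%N ->
  P.-integrable setT (fun w => (ln (cond_dens p m w (w 0%R)))%:E) /\
  \int[P]_w (ln (cond_dens p m w (w 0%R)))%:E <= - h%:E.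
Proof.
have [N N0 NP] := integrable_log_dens.
have iM m : (N <= m)%N -> P.-integrable setT (fun w => (ln (cond_dens p m w (w 0%R)))%:E).
  by move=> Nm; apply: (integrable_log_cond_dens _ _).1; apply NP => //; exact: leqW.
exists N => m Nm; split; first exact: iM.
pose e k := fine (\int[P]_w (log_dens k w)%:E).
pose c k := fine (\int[P]_w (ln (cond_dens p k w (w 0%R)))%:E).
have eE k : (N <= k)%N -> \int[P]_w (log_dens k w)%:E = (e k)%:E.
  by move=> Nk; rewrite fineK// integrable_fin_num//; exact: (NP k Nk).1.
have cE k : (N <= k)%N -> \int[P]_w (ln (cond_dens p k w (w 0%R)))%:E = (c k)%:E.
  by move=> Nk; rewrite fineK// integrable_fin_num//; exact: iM.
rewrite cE// -EFinN lee_fin.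
apply: (@cvg_average_le R e c h N) => // [k Nk|k Nk|].
- apply: EFin_inj; rewrite EFinD -!eE -?cE//; last exact: leqW.
  by apply: (integrable_log_cond_dens _ _).2; apply NP => //; exact: leqW.
(* M_k is a competitor of M_{k+1} in Gibbs' inequality, since it depends on fewer past symbols and
   has integral at most 1. *)
- rewrite -lee_fin -!cE//; last exact: leqW.
  apply: (gibbs P_stat dp (m := k.+1)).
  + exact: adapted_le (leqnSn k) (adapted_cond_dens k dp).
  + by move=> w x; exact: cond_dens_ge0 dp k w x.
  + exact: cond_dens_at0_gt0.
  + exact: integral_cond_dens_le1 P_stat dp dp k.
  + by apply: iM; exact: leqW.
  + exact: iM.
- have /fine_cvgP[_] := P_h; apply: cvg_trans; apply: near_eq_cvg.
  exists N => // k /= Nk; have [_ ->] := NP k Nk.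
  by rewrite eE// -EFinN -EFinM.
Qed.

(** Needed for all k, because the given n may be small. Below N the bound descends from M_{k+1} to
    M_k by [integral_ln_pos_lty]. *)
Lemma integral_log_cond_dens_pos k :
  \int[P]_w (Num.max (ln (cond_dens p k w (w 0%R))) 0)%:E < +oo.
Proof.
have [N NP] := integral_log_cond_dens_le.
have large m : (N <= m)%N -> \int[P]_w (Num.max (ln (cond_dens p m w (w 0%R))) 0)%:E < +oo.
  move=> /NP[/integrableP[mln fin] _]; apply: le_lt_trans fin.
  apply: ge0_le_integral => //.
  - by move=> w _; rewrite lee_fin le_max lexx orbT.
  - by apply/measurable_EFinP; apply: measurable_maxr => //; exact/measurable_EFinP.
  - exact: measurableT_comp.
  - by move=> w _; rewrite lee_fin ge_max normr_ge0 ler_norm.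
have small j : (j <= N)%N -> \int[P]_w (Num.max (ln (cond_dens p (N - j)%N w (w 0%R))) 0)%:E < +oo.
  elim: j => [|j IH] jN; first by apply: large; rewrite subn0.
  have e : (N - j)%N = (N - j.+1).+1 by rewrite subnSK.
  apply: (integral_ln_pos_lty P_stat dp (m := (N - j)%N)).
  + by rewrite e; exact: adapted_le (leqnSn _) (adapted_cond_dens _ dp).
  + by move=> w x; exact: cond_dens_ge0 dp _ w x.
  + by rewrite (le_lt_trans (integral_cond_dens_le1 P_stat dp dp _))// ltry.
  + by apply: IH; exact: ltnW.
have [kN|Nk] := leqP k N; last exact: large (ltnW Nk).
by have := small (N - k)%N; rewrite subKn//; apply; exact: leq_subr.
Qed.

End entropy.

(** * Logarithmic loss and the Cesaro mean *)

(** Jensen's inequality: the tangent of ln at the mean b is summed, and the terms x i / b add up to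
    n. *)
Lemma mean_ln_le (R : realType) n (x : 'I_n -> R) : (0 < n)%N ->
  (forall i, 0 < x i) -> n%:R^-1 * \sum_(i < n) ln (x i) <= ln (n%:R^-1 * \sum_(i < n) x i).
Proof.
move=> n0 x0; set b := n%:R^-1 * \sum_(i < n) x i.
have nR : 0 < n%:R :> R by rewrite ltr0n.
have S0 : 0 < \sum_(i < n) x i.
  case: n n0 x x0 @b nR => // n _ x x0 _ _; rewrite big_ord_recl ltr_wpDr//.
  by apply: sumr_ge0 => i _; exact: ltW.
have b0 : 0 < b by rewrite mulr_gt0// invr_gt0.
rewrite mulrC ler_pdivrMr//.
apply: (@le_trans _ _ (\sum_(i < n) (ln b + x i / b - 1))).
  by apply: ler_sum => i _; exact: ln_le_ratio.
rewrite sumrB big_split /= -mulr_suml !sumr_const card_ord.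
have -> : (\sum_(i < n) x i) / b = n%:R by rewrite /b invfM invrK mulrCA mulfV ?mulr1// gt_eqF.
by rewrite addrK mulr_natr.
Qed.

Section log_loss.
Context d (X : measurableType d) (R : realType).
Variable mu : {sigma_finite_measure set X -> \bar R}.
Local Notation seqspace := (@seqspace d X).
Variables (P Q : probability seqspace R) (p r : forall n, n.-tuple X -> R).
Hypothesis P_stat : stationary P.
Hypothesis dp : forall n, is_density mu P (@p n).
Hypothesis dr : forall n, is_density mu Q (@r n).
Hypothesis p_pos : forall k, (\int[P]_w (Num.max (ln (cond_dens p k w (w 0%R))) 0)%:E < +oo)%E.
Local Open Scope ereal_scope.

Let T k (w : seqspace) : R := ln (r (Xblock k.+1 w) / r (Xblock k w)).
Let Tpos k w : R := Num.max (T k w) 0%R.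

Let Tpos_ge0 k w : (0 <= Tpos k w)%R.
Proof. by rewrite /Tpos le_max lexx orbT. Qed.

Let r_ge0 n t : (0 <= @r n t)%R. Proof. by case: (dr n). Qed.

Let mlnE : measurable_fun setT (fun x : R => (ln x)%:E).
Proof. by apply/measurable_EFinP; exact: measurable_ln. Qed.

Let measurable_T k : measurable_fun setT (T k).
Proof. exact: (measurableT_comp (@measurable_ln R) (measurable_density_ratio dr k)). Qed.

Let measurable_Tpos k : measurable_fun setT (Tpos k).
Proof. exact: measurable_maxr. Qed.

Let integral_Tpos k : \int[P]_w (Tpos k w)%:E < +oo.
Proof.
have mphi : measurable_fun setT (fun x : R => (Num.max (ln x) 0%R)%:E).
  by apply/measurable_EFinP; apply: measurable_maxr => //; exact: measurable_ln.
have := integral_cond_dens0 P_stat dr k mphi; rewrite -/(Tpos k) => <-.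
apply: (integral_ln_pos_lty P_stat dp (m := k)) => //.
- exact: adapted_cond_dens k dr.
- by move=> w x; exact: cond_dens_ge0 dr k w x.
- by rewrite (le_lt_trans (integral_cond_dens_le1 P_stat dp dr k))// ltry.
Qed.

Let density0 w : r (Xblock 0 w) = 1%R.
Proof.
have := int_mu_pow_density dr 0; rewrite /= => -[].
by rewrite (tuple0 (Xblock 0 w)).
Qed.

Let log_density_sum n w : (forall k, (k <= n)%N -> (0 < r (Xblock k w))%R) ->
  ln (r (Xblock n w)) = (\sum_(k < n) T k w)%R.
Proof.
elim: n => [|n IH] rk; first by rewrite big_ord0 density0 ln1.
rewrite big_ord_recr /= -IH => [|k kn]; last by apply: rk; exact: leqW.
by rewrite /T ln_div ?posrE ?rk// addrC subrK.
Qed.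

Let density_support_le n :
  {ae P, forall w, (0 < r (Xblock n w))%R -> forall k, (k <= n)%N -> (0 < r (Xblock k w))%R}.
Proof.
apply: filterS (ae_foralln (density_support dp dr)) => w h rn k kn.
rewrite -(subKn kn); elim: (n - k)%N => [|j IH]; first by rewrite subn0.
have [jn|nj] := ltnP j n; last by rewrite (_ : (n - j.+1)%N = (n - j)%N)//; lia.
by apply: h; rewrite subnSK.
Qed.

Let B n w : R := (\sum_(k < n) Tpos k w)%R.

Let B_ge0 n w : (0 <= B n w)%R. Proof. exact: sumr_ge0. Qed.

Let measurable_B n : measurable_fun setT (B n).
Proof. by apply: measurable_sum => k. Qed.

Let integral_B n : \int[P]_w (B n w)%:E < +oo.
Proof.
under eq_integral do rewrite -sumEFin.
rewrite ge0_integral_sum//; last 2 first.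
- by move=> k; exact/measurable_EFinP.
- by move=> k w _; rewrite lee_fin.
by apply: lte_sum_pinfty => k _; exact: integral_Tpos.
Qed.

Let integral_log_pos n : \int[P]_w (Num.max (ln (r (Xblock n w))) 0)%:E < +oo.
Proof.
apply: le_lt_trans (integral_B n); apply: ae_ge0_le_integral => //.
- by move=> w _; rewrite lee_fin le_max lexx orbT.
- apply/measurable_EFinP; apply: measurable_maxr => //.
  exact: (measurableT_comp (@measurable_ln R) (measurable_density dr n)).
- by move=> w _; rewrite lee_fin.
- exact/measurable_EFinP.
apply: filterS (density_support_le n) => w h _.
rewrite lee_fin ge_max B_ge0 andbT.
have [rn|rn] := ltP 0%R (r (Xblock n w)); last by rewrite ln0.
rewrite log_density_sum; last exact: h.
by apply: ler_sum => k _; rewrite /Tpos le_max lexx.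
Qed.

Let I n := \int[P]_w (- lne (r (Xblock n w))%:E).

(** The positive part of the log-density has finite expectation, so the loss is well defined and
    only +oo is exceptional. Since [lne] is -oo at 0 whereas [ln] is 0 there, a finite loss forces
    positivity almost surely, and only then may [ln] replace [lne]. *)
Lemma log_loss_dichotomy n : I n = +oo \/
  [/\ {ae P, forall w, (0 < r (Xblock n w))%R},
      P.-integrable setT (fun w => (ln (r (Xblock n w)))%:E) &
      I n = - \int[P]_w (ln (r (Xblock n w)))%:E].
Proof.
pose f (w : seqspace) := - lne (r (Xblock n w))%:E.
have mf : measurable_fun setT f.
  apply: measurableT_comp => //; apply: (measurableT_comp (@measurable_lne R)).
  by apply/measurable_EFinP; exact: measurable_density dr n.
have ml : measurable_fun setT (fun w : seqspace => ln (r (Xblock n w))).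
  exact: (measurableT_comp (@measurable_ln R) (measurable_density dr n)).
have fneg : \int[P]_w f^\- w < +oo.
  apply: le_lt_trans (integral_log_pos n); apply: ge0_le_integral => //.
  - exact: measurable_funeneg.
  - by apply/measurable_EFinP; exact: measurable_maxr.
  move=> w _; rewrite funenegE /f oppeK.
  have [r0|r0] := ltP 0%R (r (Xblock n w)); first by rewrite lne_EFin// EFin_max.
  by rewrite le0_lneNy ?lee_fin// maxNye lee_fin le_max lexx orbT.
have fnfin : \int[P]_w f^\- w \is a fin_num.
  by rewrite ge0_fin_numE// integral_ge0.
have [fpos|] := ltP (\int[P]_w f^\+ w) +oo; last first.
  rewrite leye_eq => /eqP fpos; left; rewrite /I integralE fpos.
  by move: fnfin; case: (\int[P]_w f^\- w).
right; have fi : P.-integrable setT f.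
  apply/integrableP; split => //; rewrite -/(abse \o f) fune_abse.
  rewrite ge0_integralD//; [by rewrite lte_add_pinfty|exact: measurable_funepos|exact: measurable_funeneg].
have rpos : {ae P, forall w, (0 < r (Xblock n w))%R}.
  apply: filterS (integrable_ae measurableT fi) => w /(_ Logic.I).
  by rewrite /f fin_numN /=; case: leP.
have ae : ae_eq P setT f (fun w => (- ln (r (Xblock n w)))%:E).
  by apply: filterS rpos => w r0 _; rewrite /f lne_EFin.
have mN : measurable_fun setT (fun w : seqspace => (- ln (r (Xblock n w)))%:E).
  by apply/measurable_EFinP; exact: measurable_funN.
have li : P.-integrable setT (fun w => (ln (r (Xblock n w)))%:E).
  apply/integrableP; split; first exact/measurable_EFinP.
  have /integrableP[_] := fi.
  rewrite (ae_eq_integral _ _ _ _ _ (ae_eq_abse ae))//; last 2 first.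
  - exact: measurableT_comp.
  - exact: measurableT_comp.
  by under eq_integral do rewrite /= normrN.
split => //; rewrite /I -/f (ae_eq_integral _ _ _ _ _ ae)//.
rewrite -(integralN (f := fun w => (ln (r (Xblock n w)))%:E))//.
by rewrite integrable_add_def.
Qed.

Section finite_log_loss.
Variable n : nat.
Hypothesis r_pos : {ae P, forall w, (0 < r (Xblock n w))%R}.
Hypothesis log_r : P.-integrable setT (fun w => (ln (r (Xblock n w)))%:E).

Let all_pos : {ae P, forall w, forall k, (k <= n)%N -> (0 < r (Xblock k w))%R}.
Proof. by apply: filterS2 r_pos (density_support_le n) => w r0; apply. Qed.

(** An integrable sum of terms with integrable positive parts has integrable terms: the negative
    part of one term is bounded by the absolute value of the sum plus the positive parts of the
    others. *)
Let integrable_T k : (k < n)%N -> P.-integrable setT (fun w => (T k w)%:E).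
Proof.
move=> kn; apply/integrableP; split; first exact/measurable_EFinP.
have mB2 : measurable_fun setT (fun w => (B n w + B n w)%:E).
  by apply/measurable_EFinP; exact: measurable_funD.
have /integrableP[ml lfin] := log_r.
apply: (@le_lt_trans _ _ (\int[P]_w (`|(ln (r (Xblock n w)))%:E| + (B n w + B n w)%:E))).
  apply: ae_ge0_le_integral => //.
  - by apply: measurableT_comp => //; exact/measurable_EFinP.
  - by move=> w _; rewrite adde_ge0// lee_fin addr_ge0.
  - by apply: emeasurable_funD => //; exact: measurableT_comp.
  apply: filterS all_pos => w rk _; rewrite lee_fin log_density_sum//.
  pose o := Ordinal kn; have S1 : (\sum_(j < n) T j w = T k w + \sum_(j < n | j != o) T j w)%R.
    by rewrite (bigD1 o).
  have B1 : (B n w = Tpos k w + \sum_(j < n | j != o) Tpos j w)%R by rewrite /B (bigD1 o).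
  have le1 : (\sum_(j < n | j != o) T j w <= \sum_(j < n | j != o) Tpos j w)%R.
    by apply: ler_sum => j _; rewrite /Tpos le_max lexx.
  have ge1 : (0 <= \sum_(j < n | j != o) Tpos j w)%R by apply: sumr_ge0.
  have tk : (T k w <= Tpos k w)%R by rewrite /Tpos le_max lexx.
  have t0 := Tpos_ge0 k w.
  have := ler_norm (- (\sum_(j < n) T j w))%R; rewrite normrN => Sn.
  have Sp := normr_ge0 (\sum_(j < n) T j w)%R.
  by rewrite ler_norml; apply/andP; split; lra.
rewrite ge0_integralD//; last 2 first.
- exact: measurableT_comp.
- by move=> w _; rewrite lee_fin addr_ge0.
rewrite lte_add_pinfty//; under eq_integral do rewrite EFinD.
rewrite ge0_integralD//; last 4 first.
- by move=> w _; rewrite lee_fin.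
- exact/measurable_EFinP.
- by move=> w _; rewrite lee_fin.
- exact/measurable_EFinP.
by rewrite lte_add_pinfty.
Qed.

Lemma integrable_log_cond k : (k < n)%N ->
  P.-integrable setT (fun w => (ln (cond_dens r k w (w 0%R)))%:E).
Proof. by move=> kn; apply/(integrable_cond_dens0 P_stat dr k mlnE); exact: integrable_T. Qed.

Lemma integral_log_chain :
  \int[P]_w (ln (r (Xblock n w)))%:E = \sum_(k < n) \int[P]_w (ln (cond_dens r k w (w 0%R)))%:E.
Proof.
transitivity (\int[P]_w (\sum_(k < n) (T k w)%:E)).
  apply: ae_eq_integral => //.
  - exact: measurable_int log_r.
  - by apply: emeasurable_sum => k; exact/measurable_EFinP.
  - by apply: filterS all_pos => w rk _; rewrite log_density_sum// sumEFin.
rewrite integral_sum//; last by move=> k; exact: integrable_T.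
by apply: eq_bigr => k _; rewrite (integral_cond_dens0 P_stat dr k mlnE).
Qed.

(** Positivity is known along the block at times 1 to n. Stationarity moves it to time 0 as the
    vanishing expectation of an indicator. *)
Lemma cond_dens_at0_pos k : (k < n)%N -> {ae P, forall w, (0 < cond_dens r k w (w 0%R))%R}.
Proof.
move=> kn; pose phi (x : R) : \bar R := (\1_`]-oo, 0%R]%classic x)%:E.
have mphi : measurable_fun setT phi.
  by apply/measurable_EFinP; apply: measurable_indic; exact: measurable_itv.
have phi0 x : 0 <= phi x by rewrite lee_fin.
have h : \int[P]_w `|phi (cond_dens r k w (w 0%R))| = 0.
  under eq_integral do rewrite gee0_abs//.
  rewrite (integral_cond_dens0 P_stat dr k mphi) -(@integral0 _ _ _ P setT).
  apply: ae_eq_integral => //.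
    exact: (measurableT_comp mphi (measurable_density_ratio dr k)).
  apply: filterS all_pos => w rk _; rewrite /phi indicE memNset//=.
  by rewrite in_itv/=; apply/negP; rewrite -ltNge divr_gt0// rk// ltnW.
have mc := adapted_measurable0 (adapted_cond_dens k dr).
have [+ _] := ae_eq_integral_abs P measurableT (measurableT_comp mphi mc).
move=> /(_ h); apply: filterS => w /(_ Logic.I) /=; rewrite /phi indicE.
have [//|c0] := ltP 0%R (cond_dens r k w (w 0%R)).
by rewrite mem_set/= ?in_itv//= => -[] /eqP; rewrite oner_eq0.
Qed.

Hypothesis n_gt0 : (0 < n)%N.

Let b := @Defs.cesaro d X R r n.

Lemma cesaro_ge0 w x : (0 <= b w x)%R.
Proof.
by rewrite /b /Defs.cesaro mulr_ge0 ?invr_ge0// sumr_ge0// => k _; exact: cond_dens_ge0 dr k w x.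
Qed.

Lemma integral_cesaro_le1 : \int[P \x mu]_z (b z.1 z.2)%:E <= 1.
Proof.
under eq_integral do rewrite /b /Defs.cesaro EFinM -sumEFin.
have mk k : measurable_fun setT (fun z : seqspace * X => (cond_dens r k z.1 z.2)%:E).
  by apply/measurable_EFinP; exact: measurable_cond_dens dr k.
have k0 k (z : seqspace * X) : 0 <= (cond_dens r k z.1 z.2)%:E.
  by rewrite lee_fin; exact: cond_dens_ge0 dr k z.1 z.2.
rewrite ge0_integralZl//; last 2 first.
- by apply: emeasurable_sum.
- by move=> z _; apply: sume_ge0.
rewrite ge0_integral_sum//.
rewrite lee_pdivrMl ?ltr0n// mule1.
apply: (@le_trans _ _ (\sum_(i < n) 1)).
  by apply: lee_sum => i _; exact: integral_cond_dens_le1 P_stat dp dr i.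
by rewrite sumEFin lee_fin sumr_const card_ord.
Qed.

Let log_cesaro_ge : {ae P, forall w, (0 < b w (w 0%R))%R /\
  (n%:R^-1 * \sum_(k < n) ln (cond_dens r k w (w 0%R)) <= ln (b w (w 0%R)))%R}.
Proof.
have : {ae P, forall w, forall k, (k < n)%N -> (0 < cond_dens r k w (w 0%R))%R}.
  apply: ae_foralln => k; have [kn|nk] := ltnP k n.
    by apply: filterS (cond_dens_at0_pos kn) => w h _.
  exact: aeW.
apply: filterS => w h; split; last by apply: mean_ln_le => // i; exact: h.
rewrite /b /Defs.cesaro mulr_gt0 ?invr_gt0 ?ltr0n//.
rewrite (bigD1 (Ordinal n_gt0))//= ltr_wpDr//; last exact: h.
by apply: sumr_ge0 => i _; apply: ltW; exact: h.
Qed.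

Lemma cesaro_at0_pos : {ae P, forall w, (0 < b w (w 0%R))%R}.
Proof. by apply: filterS log_cesaro_ge => w []. Qed.

Let mb0 : measurable_fun setT (fun w : seqspace => b w (w 0%R)).
Proof. exact: adapted_measurable0 (adapted_cesaro dr (leqnn n)). Qed.

(** From above, the tangent bound controls the positive part; from below, concavity bounds ln b by
    the mean of integrable logarithms. *)
Lemma integrable_log_cesaro : P.-integrable setT (fun w => (ln (b w (w 0%R)))%:E).
Proof.
have mlb : measurable_fun setT (fun w : seqspace => ln (b w (w 0%R))).
  exact: (measurableT_comp (@measurable_ln R) mb0).
have mmax : measurable_fun setT (fun w : seqspace => (Num.max (ln (b w (w 0%R))) 0)%:E).
  by apply/measurable_EFinP; exact: measurable_maxr.
have lk (k : 'I_n) := integrable_log_cond (ltn_ord k).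
have mS : measurable_fun setT (fun w => \sum_(k < n) `|(ln (cond_dens r k w (w 0%R)))%:E|).
  by apply: emeasurable_sum => k; apply: measurableT_comp => //; exact: measurable_int (lk k).
apply/integrableP; split; first exact/measurable_EFinP.
apply: (@le_lt_trans _ _ (\int[P]_w ((Num.max (ln (b w (w 0%R))) 0)%:E +
    \sum_(k < n) `|(ln (cond_dens r k w (w 0%R)))%:E|))).
  apply: ae_ge0_le_integral => //.
  - by apply: measurableT_comp => //; exact/measurable_EFinP.
  - move=> w _; apply: adde_ge0; first by rewrite lee_fin le_max lexx orbT.
    exact: sume_ge0.
  - exact: emeasurable_funD.
  apply: filterS log_cesaro_ge => w [_ h] _.
  under eq_bigr do rewrite abse_EFin.
  rewrite sumEFin -EFinD lee_fin.
  set S := (\sum_(k < n) `|_|)%R.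
  have S0 : (0 <= S)%R by apply: sumr_ge0.
  have : (- S <= n%:R^-1 * \sum_(k < n) ln (cond_dens r k w (w 0%R)))%R.
    apply: (@le_trans _ _ (n%:R^-1 * - S)%R).
      rewrite mulrN lerN2 ler_piMl// invf_le1 ?ltr0n// ler1n//.
    rewrite ler_wpM2l ?invr_ge0// -sumrN; apply: ler_sum => k _.
    by rewrite lerNl -normrN ler_norm.
  move=> h2; rewrite ler_norml; apply/andP; split.
    have : (0 <= Num.max (ln (b w (w 0))) 0)%R by rewrite le_max lexx orbT.
    by lra.
  have : (ln (b w (w 0)) <= Num.max (ln (b w (w 0))) 0)%R by rewrite le_max lexx.
  by lra.
rewrite ge0_integralD//; last 2 first.
- by move=> w _; rewrite lee_fin le_max lexx orbT.
- by move=> w _; exact: sume_ge0.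
rewrite lte_add_pinfty//.
  apply: (integral_ln_pos_lty P_stat dp (adapted_cesaro dr (leqnn n)) cesaro_ge0) => //.
  by rewrite (le_lt_trans integral_cesaro_le1)// ltry.
rewrite ge0_integral_sum//; last first.
  by move=> k; apply: measurableT_comp => //; exact: measurable_int (lk k).
by apply: lte_sum_pinfty => k _; have /integrableP[] := lk k.
Qed.

Lemma log_loss_cesaro :
  - (\int[P]_w (ln (b w (w 0%R)))%:E) <=
  - (\int[P]_w (ln (r (Xblock n w)))%:E) * (n%:R^-1)%:E.
Proof.
have lk (k : 'I_n) := integrable_log_cond (ltn_ord k).
rewrite mulNe leeN2 integral_log_chain -integral_sum//.
rewrite muleC -integralZl//; last exact: integrable_sum.
under eq_integral do rewrite sumEFin -EFinM.
apply: ae_le_integral_EFin.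
- under [X in integrable _ _ X]eq_fun do rewrite EFinM -sumEFin.
  by apply: integrableZl => //; exact: integrable_sum.
- exact: integrable_log_cesaro.
- by apply: filterS log_cesaro_ge => w [].
Qed.

End finite_log_loss.
End log_loss.

(** * Divergence of the limiting conditional density *)

Section bregman.
Context {R : realType}.
Implicit Types a b : R.

(* The integrand of the Kullback-Leibler divergence, made nonnegative by adding b - a. *)
Definition bregman a b : \bar R :=
  if a == 0 then b%:E else if b == 0 then +oo%E else (a * (ln a - ln b) - a + b)%:E.

(** The tangent bound at the square roots, multiplied by 2 a. The squared Hellinger term is
    continuous up to a = 0 and equals b there, so besides the sign it gives lower semicontinuity at
    0. *)
Lemma bregman_ge_hellinger a b : 0 <= a -> 0 <= b ->
  (((Num.sqrt a - Num.sqrt b) ^+ 2)%:E <= bregman a b)%E.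
Proof.
move=> a0 b0; rewrite /bregman sqrrB !sqr_sqrtr//.
have [->|an0] := eqVneq a 0; first by rewrite sqrtr0 mul0r mul0rn subr0 add0r.
have [->|bn0] := eqVneq b 0; first by rewrite leey.
have {an0}a0 : 0 < a by rewrite lt0r an0.
have {bn0}b0 : 0 < b by rewrite lt0r bn0.
have sa : 0 < Num.sqrt a by rewrite sqrtr_gt0.
have sb : 0 < Num.sqrt b by rewrite sqrtr_gt0.
have lnsq (x : R) : 0 < x -> ln x = ln (Num.sqrt x) + ln (Num.sqrt x).
  by move=> x0; rewrite -lnM ?posrE ?sqrtr_gt0// -expr2 sqr_sqrtr// ltW.
have := ln_le_ratio sa sb; rewrite lee_fin -mulr_natr.
rewrite (lnsq a)// (lnsq b)//.
set la := ln (Num.sqrt a); set lb := ln (Num.sqrt b).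
set x := Num.sqrt a in sa *; set y := Num.sqrt b in sb *.
have -> : a = x ^+ 2 by rewrite sqr_sqrtr// ltW.
have -> : b = y ^+ 2 by rewrite sqr_sqrtr// ltW.
move=> h; have : (lb - la + 1) * x <= y.
  by rewrite -ler_pdivlMr//; lra.
move=> h2; nra.
Qed.

Lemma bregman_ge0 a b : 0 <= a -> 0 <= b -> (0 <= bregman a b)%E.
Proof.
by move=> a0 b0; apply: le_trans (bregman_ge_hellinger a0 b0); rewrite lee_fin sqr_ge0.
Qed.

Lemma KLterm_bregman a b : 0 <= a -> 0 <= b ->
  (KLterm a%:E b = bregman a b + a%:E - b%:E)%E.
Proof.
move=> a0 b0; rewrite /KLterm /bregman eqe.
have [->|an0] := eqVneq a 0; first by rewrite adde0 -EFinB subrr.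
have {an0}a0 : 0 < a by rewrite lt0r an0.
have [->|bn0] := eqVneq b 0.
  by rewrite (@le0_lneNy _ 0%:E)// lne_EFin// addeC/= gt0_muley ?lte_fin.
have {bn0}b0 : 0 < b by rewrite lt0r bn0.
by rewrite !lne_EFin// -!EFinD -EFinM; congr EFin; ring.
Qed.

Lemma measurable_bregman d (T : measurableType d) (f g : T -> R) :
  measurable_fun setT f -> measurable_fun setT g ->
  measurable_fun setT (fun x => bregman (f x) (g x)).
Proof.
move=> mf mg; have mln := @measurable_ln R.
have m0 (u : T -> R) : measurable_fun setT u -> measurable_fun setT (fun x => u x == 0).
  by move=> mu; exact: measurable_fun_eqr.
have m3 : measurable_fun setT (fun x => (f x * (ln (f x) - ln (g x)) - f x + g x)%:E).
  apply/measurable_EFinP/measurable_funD => //; apply: measurable_funB => //.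
  by apply: measurable_funM => //; apply: measurable_funB; apply: (measurableT_comp mln).
have m2 := measurable_fun_ifT (m0 _ mg) (@measurable_cst _ _ T _ setT (+oo%E : \bar R)) m3.
have mgE : measurable_fun setT (fun x => (g x)%:E) by exact/measurable_EFinP.
exact: (measurable_fun_ifT (m0 _ mf) mgE m2).
Qed.

Lemma le_limn_einf (u v : (\bar R)^nat) : (forall n, u n <= v n)%E ->
  (limn_einf u <= limn_einf v)%E.
Proof.
move=> uv; rewrite !limn_einf_lim; apply: lee_lim; try exact: is_cvg_einfs.
apply: nearW => n; apply: le_ereal_inf_tmp => _ [m /= nm <-].
by apply: le_trans (uv m); apply: ereal_inf_lbound; exists m.
Qed.

Lemma limn_einf_le (u : (\bar R)^nat) C : (\forall n \near \oo, u n <= C)%E ->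
  (limn_einf u <= C)%E.
Proof.
move=> [N _ NP]; rewrite limn_einf_lim; apply: lime_le; first exact: is_cvg_einfs.
apply: nearW => n; apply: (@le_trans _ _ (u (maxn n N))).
  by apply: ereal_inf_lbound; exists (maxn n N) => //=; rewrite leq_maxl.
by apply: NP; rewrite /= leq_maxr.
Qed.

Lemma bregman_le_limn_einf (u : nat -> R) a b : (forall n, 0 <= u n) -> 0 <= b ->
  u @ \oo --> a -> (bregman a b <= limn_einf (fun n => bregman (u n) b))%E.
Proof.
move=> u0 b0 ua.
have a0 : 0 <= a.
  rewrite -(cvg_lim _ ua)//; apply: limr_ge; last exact: nearW.
  by apply/cvg_ex; exists a.
(* At 0 the sequence may alternate between both formulas of [bregman], so the Hellinger minorant is
   used. For positive a the sequence is eventually positive and [bregman] converges, being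
   constantly +oo when b = 0. *)
have [a_eq0|an0] := eqVneq a 0.
  rewrite a_eq0 in ua *.
  have sl : Num.sqrt (u n) - Num.sqrt b @[n --> \oo] --> Num.sqrt 0 - Num.sqrt b.
    by apply: cvgB; [exact: (cvg_comp _ _ ua (@sqrt_continuous R 0))|exact: cvg_cst].
  have vl : ((Num.sqrt (u n) - Num.sqrt b) ^+ 2)%:E @[n --> \oo] --> b%:E.
    rewrite -[X in _ --> X%:E](sqr_sqrtr b0) -sqrrN -[X in X ^+ 2]add0r -{1}(sqrtr0 R).
    by apply: cvg_EFin; [exact: nearW|exact: (cvgM sl sl)].
  rewrite {1}/bregman eqxx.
  rewrite -(cvg_lim _ vl)// -is_cvg_limn_einfE; last by apply/cvg_ex; exists b%:E.
  by apply: le_limn_einf => n; exact: bregman_ge_hellinger.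
have {an0}a0' : 0 < a by rewrite lt0r an0.
have upos : \forall n \near \oo, 0 < u n by exact: (cvgr_gt a ua).
suff bl : (fun n => bregman (u n) b) @ \oo --> bregman a b.
  by rewrite is_cvg_limn_einfE ?(cvg_lim _ bl)//; apply/cvg_ex; exists (bregman a b).
have [->|bn0] := eqVneq b 0.
  rewrite {2}/bregman gt_eqF// eqxx; apply: cvg_near_cst.
  by apply: filterS upos => n un; rewrite /bregman gt_eqF// eqxx.
rewrite {2}/bregman gt_eqF// (negbTE bn0).
have key : (u n * (ln (u n) - ln b) - u n + b)%:E @[n --> \oo] -->
    (a * (ln a - ln b) - a + b)%:E.
  apply: cvg_EFin; first exact: nearW.
  have lnu : ln (u n) @[n --> \oo] --> ln a by exact: (cvg_comp _ _ ua (continuous_ln a0')).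
  apply: cvgD; last exact: cvg_cst.
  apply: cvgB => //; apply: cvgM => //; apply: cvgB => //; exact: cvg_cst.
apply: cvg_trans key; apply: near_eq_cvg.
by apply: filterS upos => n un; rewrite /bregman gt_eqF// (negbTE bn0).
Qed.

End bregman.

(** * Fatou's lemma and the bound on the expected divergence *)

Section divergence.
Context d (X : measurableType d) (R : realType).
Variable mu : {sigma_finite_measure set X -> \bar R}.
Local Notation seqspace := (@seqspace d X).
Variables (P : probability seqspace R) (p : forall n, n.-tuple X -> R).
Hypothesis P_stat : stationary P.
Hypothesis dp : forall n, is_density mu P (@p n).
Local Open Scope ereal_scope.
Variable b : seqspace -> X -> R.
Hypothesis b_ge0 : forall w x, (0 <= b w x)%R.
Hypothesis b_le1 : \int[P \x mu]_z (b z.1 z.2)%:E <= 1.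
Hypothesis b_pos : {ae P, forall w, (0 < b w (w 0%R))%R}.
Hypothesis log_b : P.-integrable setT (fun w => (ln (b w (w 0%R)))%:E).

Let M m (z : seqspace * X) : R := cond_dens p m z.1 z.2.

Let M_ge0 m z : (0 <= M m z)%R. Proof. exact: cond_dens_ge0 dp m z.1 z.2. Qed.

Let measurable_M m : measurable_fun setT (M m).
Proof. exact: measurable_cond_dens dp m. Qed.

(** Where M_m is nonzero the integrand is M_m times a function of the tuple, so it becomes an
    expectation containing b / M_m, that is, the integral of b off the zeros of M_m. At the zeros
    the integrand is b itself, and the two parts of the integral of b recombine. *)
Lemma integral_bregman m : adapted m b ->
  P.-integrable setT (fun w => (ln (cond_dens p m w (w 0%R)))%:E) ->
  \int[P \x mu]_z bregman (M m z) (b z.1 z.2) =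
  \int[P]_w (ln (cond_dens p m w (w 0%R)))%:E - \int[P]_w (ln (b w (w 0%R)))%:E - 1
  + \int[P \x mu]_z (b z.1 z.2)%:E.
Proof.
move=> ab iM; have [g mg bg] := ab.
have mb := adapted_measurable ab.
have mb0 := adapted_measurable0 ab.
have mk : measurable_fun setT (@cond_ratio _ X R p m) by exact: measurable_cond_ratio dp m.
(* The absolute values make the tuple function nonnegative everywhere, as the change of measure
   demands. Where M_m and b are positive the outer one changes nothing, by the tangent bound; +oo is
   the value for b = 0. *)
pose L (u v : R) : \bar R := if (v == 0)%R then +oo else `|ln u - ln v - 1 + v / u|%:E.
pose G t := L (@cond_ratio _ X R p m t) `|g t|%R.
have mng : measurable_fun setT (fun t => `|g t|%R) by exact: measurableT_comp.
have mG : measurable_fun setT G.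
  have m1 : measurable_fun setT (fun t => (`|g t| == 0)%R) by exact: measurable_fun_eqr.
  have m2 : measurable_fun setT (fun t =>
      `|ln (@cond_ratio _ X R p m t) - ln `|g t| - 1 + `|g t| / @cond_ratio _ X R p m t|%:E).
    apply/measurable_EFinP; apply: measurableT_comp => //.
    apply: measurable_funD; last first.
      by apply: measurable_divr_ge0 => //; exact: cond_ratio_ge0 dp m.
    apply: measurable_funB => //.
    by apply: measurable_funB; apply: (measurableT_comp (@measurable_ln R)).
  exact: (measurable_fun_ifT m1 (@measurable_cst _ _ _ _ setT (+oo : \bar R)) m2).
have G0 t : 0 <= G t by rewrite /G /L; case: ifP => // _; rewrite lee_fin.
have G_b w x : G (past_with m w x) = L (cond_dens p m w x) (b w x).
  by rewrite /G -bg cond_densE ger0_norm.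
have split z : bregman (M m z) (b z.1 z.2) =
    (M m z)%:E * G (past_with m z.1 z.2) + (b z.1 z.2 * (M m z == 0)%R%:R)%:E.
  rewrite G_b -/(M m z) /bregman /L.
  have [->|Mn0] := eqVneq (M m z) 0%R; first by rewrite mul0e add0e mulr1.
  have Mz : (0 < M m z)%R by rewrite lt0r Mn0 M_ge0.
  rewrite mulr0 adde0; have [_|bn0] := eqVneq (b z.1 z.2) 0%R.
    by rewrite gt0_muley// lte_fin.
  have bz : (0 < b z.1 z.2)%R by rewrite lt0r bn0 b_ge0.
  rewrite ger0_norm; last by have := ln_le_ratio Mz bz; lra.
  by rewrite -EFinM; congr EFin; field.
have mind (f : seqspace * X -> bool) : measurable [set z | f z] ->
    measurable_fun setT (fun z => (f z)%:R : R).
  move=> mf; rewrite (_ : (fun _ => _) = \1_[set z | f z]); first exact: measurable_indic.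
  by apply/funext => z; rewrite indicE; congr ((_ : bool)%:R); apply/idP/idP; rewrite inE.
have mM0 : measurable [set z | (M m z == 0)%R].
  rewrite (_ : mkset _ = [set z | M m z = 0%R]); first exact: measurable_eq0.
  by apply/seteqP; split => z /= /eqP.
have mMn0 : measurable [set z | (M m z != 0)%R].
  rewrite (_ : mkset _ = ~` [set z | (M m z == 0)%R]); first exact: measurableC.
  by apply/seteqP; split => z /= /negP.
have mb1 : measurable_fun setT (fun z => (b z.1 z.2 * (M m z == 0)%R%:R)%:E).
  by apply/measurable_EFinP; apply: measurable_funM => //; exact: mind.
have mb2 : measurable_fun setT (fun z => (b z.1 z.2 * (M m z != 0)%R%:R)%:E).
  by apply/measurable_EFinP; apply: measurable_funM => //; exact: mind.
have bsplit : \int[P \x mu]_z (b z.1 z.2)%:E =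
    \int[P \x mu]_z (b z.1 z.2 * (M m z != 0)%R%:R)%:E +
    \int[P \x mu]_z (b z.1 z.2 * (M m z == 0)%R%:R)%:E.
  rewrite -ge0_integralD//.
  - apply: eq_integral => z _; rewrite -EFinD -mulrDr.
    by case: eqP => _; rewrite /= ?add0r ?addr0 mulr1.
  - by move=> z _; rewrite lee_fin mulr_ge0.
  - by move=> z _; rewrite lee_fin mulr_ge0.
rewrite bsplit -(integral_ratio0 P_stat dp ab b_ge0) addeA.
transitivity (\int[P \x mu]_z ((cond_dens p m z.1 z.2)%:E * G (past_with m z.1 z.2)) +
   \int[P \x mu]_z (b z.1 z.2 * (M m z == 0)%R%:R)%:E).
  under eq_integral do rewrite split.
  rewrite ge0_integralD//.
  - by move=> z _; rewrite mule_ge0// lee_fin.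
  - apply: emeasurable_funM; first exact/measurable_EFinP.
    exact: (measurableT_comp mG (@measurable_past_with _ X m)).
  - by move=> z _; rewrite lee_fin mulr_ge0.
congr (_ + _); rewrite (integral_cond_dens P_stat dp mG G0).
have mM0w := adapted_measurable0 (adapted_cond_dens m dp).
have mq : measurable_fun setT (fun w : seqspace => (b w (w 0%R) / cond_dens p m w (w 0%R))%R).
  by apply: measurable_divr_ge0 => // w; exact: M_ge0 m (w, w 0%R).
have q0 w : (0 <= b w (w 0%R) / cond_dens p m w (w 0%R))%R.
  by rewrite divr_ge0//; exact: M_ge0 m (w, w 0%R).
have iq : P.-integrable setT (fun w => (b w (w 0%R) / cond_dens p m w (w 0%R))%:E).
  apply/integrableP; split; first exact/measurable_EFinP.
  under eq_integral do rewrite gee0_abs ?lee_fin//.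
  apply: le_lt_trans (integral_ratio0_le P_stat dp ab b_ge0) _.
  by rewrite (le_lt_trans b_le1)// ltry.
have i1 : P.-integrable setT (fun=> 1%:E) by exact: finite_measure_integrable_cst.
have int1 : \int[P]_w (1:R)%:E = 1.
  by rewrite (integral_cst P measurableT 1%:E) mul1e; exact: probability_setT.
rewrite -{1}int1 -integralB// -integralB//; last exact: integrableB.
rewrite -integralD//; last by apply: integrableB => //; exact: integrableB.
apply: ae_eq_integral => //.
- exact: (measurableT_comp mG (@measurable_past_with0 _ X m)).
- by apply: (@measurable_int _ _ _ P); apply: integrableD => //; do 2 apply: integrableB => //.
- apply: filterS2 b_pos (cond_dens_at0_gt0 P_stat dp m) => w bw Mw _.
  rewrite G_b /L gt_eqF// ger0_norm//.
  by have := ln_le_ratio Mw bw; lra.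
Qed.

Variables (n : nat) (C : \bar R).
Hypothesis b_adapted : forall m, (n <= m)%N -> adapted m b.
Hypothesis log_M : exists N, forall m, (N <= m)%N ->
  P.-integrable setT (fun w => (ln (cond_dens p m w (w 0%R)))%:E) /\
  \int[P]_w (ln (cond_dens p m w (w 0%R)))%:E <= C.

(** Unlike the [lim] in [cond_inf], the lower limit is meaningful at every point. Fatou bounds its
    integral by 1, so it is finite almost everywhere and [alpha] loses nothing. *)
Let Minf z : \bar R := limn_einf (fun k => (M k z)%:E).
Let alpha z : R := fine (Minf z).

Let mME m : measurable_fun setT (fun z => (M m z)%:E).
Proof. exact/measurable_EFinP. Qed.

Let measurable_einf (f : nat -> seqspace * X -> \bar R) :
  (forall k, measurable_fun setT (f k)) ->
  measurable_fun setT (fun z => limn_einf (f ^~ z)).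
Proof.
move=> mf; rewrite /limn_einf; apply: measurableT_comp => //.
apply: (@measurable_fun_limn_esup _ _ _ setT (fun k z => - f k z)) => k.
exact: measurableT_comp.
Qed.

Let measurable_Minf : measurable_fun setT Minf.
Proof. exact: (measurable_einf mME). Qed.

Let Minf_ge0 z : 0 <= Minf z.
Proof.
rewrite /Minf limn_einf_lim; apply: lime_ge; first exact: is_cvg_einfs.
by apply: nearW => k; apply: le_ereal_inf_tmp => _ [j _ <-]; rewrite lee_fin.
Qed.

Let measurable_alpha : measurable_fun setT alpha.
Proof. by rewrite /alpha; apply: measurableT_comp => //; exact: fine_measurable. Qed.

Let alpha_ge0 z : (0 <= alpha z)%R. Proof. exact: fine_ge0. Qed.

Let integral_M m : \int[P \x mu]_z (M m z)%:E = 1.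
Proof.
pose one (w : seqspace) (x : X) : R := 1%R.
have a1 : adapted m one by exists (fun=> 1%R).
have h01 : forall w x, (0 <= one w x)%R by [].
have := integral_adapted0 P_stat dp a1 h01.
rewrite [RHS](integral_cst P measurableT 1%:E) mul1e => e.
transitivity (P setT); last exact: probability_setT.
by rewrite -e; apply: eq_integral => z _; rewrite mulr1.
Qed.

Let integral_Minf : \int[P \x mu]_z Minf z <= 1.
Proof.
apply: le_trans (fatou _ measurableT mME _) _ => [m z _|]; first by rewrite lee_fin.
by apply: limn_einf_le; apply: nearW => m; rewrite integral_M.
Qed.

Let Minf_ae : {ae P \x mu, forall z, M ^~ z @ \oo --> alpha z /\ Minf z = (alpha z)%:E /\
  cond_inf p z.1 z.2 = (alpha z)%:E}.
Proof.
have iM : (P \x mu).-integrable setT Minf.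
  apply/integrableP; split => //; under eq_integral do rewrite gee0_abs//.
  by rewrite (le_lt_trans integral_Minf)// ltry.
have := integrable_ae measurableT iM; apply: filterS2 (ae_cvg_cond_dens P_stat dp).
move=> z cz /(_ Logic.I) fz; have e : Minf z = (alpha z)%:E by rewrite /alpha fineK.
have lz : cond_inf p z.1 z.2 = (alpha z)%:E.
  by rewrite -e /Minf is_cvg_limn_einfE.
split; last by [].
have : (fun k => (M k z)%:E) @ \oo --> (alpha z)%:E by rewrite -lz.
by move=> /fine_cvgP[_].
Qed.

Let mb : measurable_fun setT (fun z : seqspace * X => b z.1 z.2).
Proof. exact: adapted_measurable (b_adapted (leqnn n)). Qed.

Let br z := bregman (alpha z) (b z.1 z.2).

Let measurable_br : measurable_fun setT br.
Proof. exact: measurable_bregman. Qed.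

Let br_ge0 z : 0 <= br z. Proof. exact: bregman_ge0. Qed.

Let integral_br : \int[P \x mu]_z br z <=
  C - \int[P]_w (ln (b w (w 0%R)))%:E - 1 + \int[P \x mu]_z (b z.1 z.2)%:E.
Proof.
have mbr m : measurable_fun setT (fun z => bregman (M m z) (b z.1 z.2)).
  exact: measurable_bregman.
have br0 m z : 0 <= bregman (M m z) (b z.1 z.2) by exact: bregman_ge0.
apply: (@le_trans _ _ (\int[P \x mu]_z limn_einf (fun m => bregman (M m z) (b z.1 z.2)))).
  apply: ae_ge0_le_integral => //.
  - move=> z _; rewrite limn_einf_lim; apply: lime_ge; first exact: is_cvg_einfs.
    by apply: nearW => k; apply: le_ereal_inf_tmp => _ [j _ <-].
  - exact: measurable_einf.
  - apply: filterS Minf_ae => z [cz _] _.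
    exact: (bregman_le_limn_einf (M_ge0 ^~ z) (b_ge0 z.1 z.2) cz).
apply: le_trans (fatou _ measurableT mbr _) _ => [m z _|]; first exact: br0.
have [N NP] := log_M; apply: limn_einf_le; exists (maxn n N) => // m /=.
rewrite geq_max => /andP[nm Nm]; have [iM Mle] := NP m Nm.
by rewrite integral_bregman//; [do 3 apply: leeD2r|exact: b_adapted].
Qed.

Hypothesis C_fin : C \is a fin_num.

(** The divergence integrand is the Bregman one plus [alpha] minus b. The integral of b cancels, and
    the term - 1 absorbs the integral of [alpha]. *)
Lemma integral_Dinf_le (D : seqspace -> \bar R) :
  (forall w, D w = \int[mu]_x KLterm (cond_inf p w x) (b w x)) ->
  \int[P]_w D w <= C - \int[P]_w (ln (b w (w 0%R)))%:E.
Proof.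
move=> DE; under eq_integral do rewrite DE.
have lfin := integrable_fin_num measurableT log_b.
have b0 : 0 <= \int[P \x mu]_z (b z.1 z.2)%:E by apply: integral_ge0 => z _; rewrite lee_fin.
have bfin : \int[P \x mu]_z (b z.1 z.2)%:E \is a fin_num.
  by rewrite ge0_fin_numE// (le_lt_trans b_le1)// ltry.
have ib : (P \x mu).-integrable setT (fun z => (b z.1 z.2)%:E).
  apply/integrableP; split; first exact/measurable_EFinP.
  by under eq_integral do rewrite gee0_abs ?lee_fin//; rewrite (le_lt_trans b_le1)// ltry.
have a_le1 : \int[P \x mu]_z (alpha z)%:E <= 1.
  apply: le_trans integral_Minf; apply: ae_ge0_le_integral => //.
  - by move=> z _; rewrite lee_fin.
  - exact/measurable_EFinP.
  - by apply: filterS Minf_ae => z [_ [-> _]].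
have a0 : 0 <= \int[P \x mu]_z (alpha z)%:E by apply: integral_ge0 => z _; rewrite lee_fin.
have ia : (P \x mu).-integrable setT (fun z => (alpha z)%:E).
  apply/integrableP; split; first exact/measurable_EFinP.
  by under eq_integral do rewrite gee0_abs ?lee_fin//; rewrite (le_lt_trans a_le1)// ltry.
have ibr : (P \x mu).-integrable setT br.
  apply/integrableP; split => //; under eq_integral do rewrite gee0_abs//.
  apply: le_lt_trans integral_br _; rewrite -ge0_fin_numE; last first.
    by apply: le_trans integral_br; exact: integral_ge0.
  by rewrite -(fineK C_fin) -(fineK lfin) -(fineK bfin).
pose K z := KLterm (cond_inf p z.1 z.2) (b z.1 z.2).
have iJ : (P \x mu).-integrable setT (fun z => br z + (alpha z)%:E - (b z.1 z.2)%:E).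
  by apply: integrableB => //; exact: integrableD.
have aeK : ae_eq (P \x mu) setT K (fun z => br z + (alpha z)%:E - (b z.1 z.2)%:E).
  apply: filterS Minf_ae => z [_ [_ ez]] _.
  by rewrite /K ez KLterm_bregman.
(* Fubini needs genuine measurability, not almost everywhere equality with a measurable function.
   Where the sequence diverges, [lim] takes the fixed value [point]. *)
have mcond : measurable_fun setT (fun z : seqspace * X => cond_inf p z.1 z.2).
  pose Msup z := limn_esup (fun k => (M k z)%:E).
  have msup : measurable_fun setT Msup by exact: measurable_fun_limn_esup.
  rewrite (_ : (fun _ => _) = fun z => if Minf z == Msup z then Minf z else point).
    apply: (@measurable_fun_ifT _ _ _ _ Minf _ (fun z => Minf z == Msup z)) => //.
    exact: measurable_fun_eqe.
  apply/funext => z; case: eqP => [e|ne].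
    rewrite /cond_inf e; apply: cvg_lim => //.
    exact: (cvgn_limn_einf_eq_esup e).
  apply: dvgP => c; apply: ne; rewrite /Minf /Msup.
  by rewrite is_cvg_limn_einfE// is_cvg_limn_esupE.
have mK : measurable_fun setT K.
  have m1 : measurable_fun setT (fun z : seqspace * X => cond_inf p z.1 z.2 == 0) by exact: measurable_fun_eqe.
  have mbE : measurable_fun setT (fun z : seqspace * X => (b z.1 z.2)%:E) by exact/measurable_EFinP.
  have m2 : measurable_fun setT (fun z : seqspace * X =>
      cond_inf p z.1 z.2 * (lne (cond_inf p z.1 z.2) - lne (b z.1 z.2)%:E)).
    apply: emeasurable_funM => //; apply: emeasurable_funB.
      exact: (measurableT_comp (@measurable_lne R)).
    exact: (measurableT_comp (@measurable_lne R)).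
  exact: (measurable_fun_ifT m1 (@measurable_cst _ _ _ _ setT (0 : \bar R)) m2).
have iK : (P \x mu).-integrable setT K.
  apply/integrableP; split => //; have /integrableP[mJ] := iJ; apply: le_lt_trans.
  by rewrite (ae_eq_integral _ _ _ _ _ (ae_eq_abse aeK))//; exact: measurableT_comp.
(* The integrand has no sign, so passing from the iterated to the product integral rests on its
   integrability. *)
have := integral12_prod_meas1 iK; rewrite /fubini_F /K /= => ->.
rewrite -/K (ae_eq_integral _ _ _ _ _ aeK)//; last exact: measurable_int iJ.
rewrite integralB//; last exact: integrableD.
rewrite integralD//.
have := integral_br.
have brfin := integrable_fin_num measurableT ibr.
have afin := integrable_fin_num measurableT ia.
rewrite -(fineK brfin) -(fineK afin) -(fineK bfin) -(fineK lfin) -(fineK C_fin) in a_le1 *.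
rewrite -!EFinN -!EFinD !lee_fin in a_le1 *.
by move=> h; lra.
Qed.

End divergence.

Unset Implicit Arguments. Set Strict Implicit. Set Printing Implicit Defensive.

Theorem mainTheorem5 (d : measure_display) (X : measurableType d) (R : realType)
  (mu : {measure set X -> \bar R})
  (Xcg : countably_generated (X := X))
  (mu_sf : sigma_finite setT mu)
  (P : probability (seqspace (X := X)) R)
  (p : forall n : nat, n.-tuple X -> R)
  (h : R)
  (P_stat : stationary P) (P_erg : ergodic P)
  (P_dens : forall n : nat, is_density mu P (p n))
  (P_h : (fun n : nat => ((\int[P]_w (- lne (p n (Xblock n w))%:E)) * (n%:R^-1)%:E)%E)
            @ \oo --> h%:E)
  (Q : probability (seqspace (X := X)) R)
  (r : forall n : nat, n.-tuple X -> R)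
  (Q_dens : forall n : nat, is_density mu Q (r n))
  (n : nat) (n_ge1 : (1 <= n)%N) :
  ((\int[P]_w (- lne (r n (Xblock n w))%:E)) * (n%:R^-1)%:E - h%:E
    >= \int[P]_w Dinf mu p r n w)%E.
Proof.
(* The measure is repackaged with its sigma-finiteness around the same set function, so hypotheses
   and goal about [mu] carry over by conversion. *)
pose mu_measure := isMeasure.Build _ _ _ (Measure.sort mu) (measure0 mu) (measure_ge0 mu)
  (@measure_semi_sigma_additive _ _ _ mu).
pose mu' : measure X R := HB.pack_for (measure X R) (Measure.sort mu) mu_measure.
pose mu_sigma := Measure_isSigmaFinite.Build _ _ _ (Measure.sort mu') mu_sf.
pose nu := HB.pack_for (sigma_finite_measure X R) (Measure.sort mu') mu_sigma.
have dp k : is_density nu P (p k) by exact: P_dens.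
have dr k : is_density nu Q (r k) by exact: Q_dens.
have log_p_pos := integral_log_cond_dens_pos P_stat dp P_h.
case: (log_loss_dichotomy P_stat dp dr log_p_pos n) => [->|[r_pos log_r ->]].
  (* An infinite log loss makes the larger side +oo, as h is real. *)
  by rewrite gt0_mulye ?lte_fin ?invr_gt0 ?ltr0n// leey.
have log_b := integrable_log_cesaro P_stat dp dr log_p_pos r_pos log_r n_ge1.
apply: le_trans (integral_Dinf_le P_stat dp (cesaro_ge0 dr n)
  (integral_cesaro_le1 P_stat dp dr n_ge1) (cesaro_at0_pos P_stat dp dr r_pos n_ge1) log_b
  (n := n) (C := (- h)%:E) _ _ _ (D := Dinf mu p r n) _) _ => //.
- by move=> m nm; exact: adapted_cesaro dr nm.
- have [N NP] := integral_log_cond_dens_le P_stat dp P_h; by exists N.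
- rewrite EFinN addeC; apply: leeD2r.
  exact: (log_loss_cesaro P_stat dp dr log_p_pos r_pos log_r n_ge1).
Qed.
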